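(* Let $P,Q$ be projective modules over a Noetherian commutative ring $R$. Then: (i) If $R$ is s-slender, then $P^{\ast}\cong_R Q^{\ast}$ implies $P\cong_R Q$. (ii) If $R$ is p-slender and there is an injective $R$-linear map $Q^{\ast}\to P^{\ast}$, then there is a surjective $R$-linear map $P\to Q$. (iii) If $R$ is t-slender and $P,Q$ are free $R$-modules, then: (a) if there is an injective $R$-linear map $Q^{\ast}\to P^{\ast}$, then there is a surjective $R$-linear map $P\to Q$; (b) $P^{\ast}\cong_R Q^{\ast}$ implies $P\cong_R Q$.
   Context: Rings are unital and non-zero; ring homomorphisms preserve $1$. $M^{\ast}=\mathrm{Hom}_R(M,R)$. $R^{\omega}$ is the direct product of countably many copies of $R$, with standard unit vectors $e_i$. A commutative ring $R$ is slender if for every $f\in\mathrm{Hom}_R(R^{\omega},R)$ the set $\{i\in\omega:f(e_i)\neq0\}$ is finite. It is w-slender if there is a ring homomorphism $\phi:R\to S$ with $S$ a commutative slender ring that is finitely presented as an $R$-module via $\phi$. A ring is QS (Quillen–Suslin) if all its finitely generated projective modules are free. A Noetherian commutative ring $R$ is a finite product $R=\prod_{k=1}^{n}R_k$ of connected Noetherian rings (rings with no idempotents other than $0,1$), its connected components. $R$ is s-slender if every $R_k$ is w-slender; $R$ is t-slender if some $R_k$ is slender; $R$ is p-slender if every $R_k$ is both slender and QS. *)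

(* Defs.v *)
From HB Require Import structures.
From mathcomp Require Import all_boot all_order all_algebra.
From mathcomp Require Import boolp classical_sets functions cardinality.

Set Implicit Arguments.
Unset Strict Implicit.
Unset Printing Implicit Defensive.

Import GRing.Theory.

Local Open Scope classical_set_scope.
Local Open Scope ring_scope.

Definition surjective (A B : Type) (f : A -> B) : Prop :=
  forall y, exists x, f x = y.

Definition isomorphic (R : comNzRingType) (M N : lmodType R) : Prop :=
  exists f : {linear M -> N}, bijective f.

Definition dual (R : comNzRingType) (M : lmodType R) : Type :=
  {linear M -> R^o}.

Section DualModule.
Variables (R : comNzRingType) (M : lmodType R).
Implicit Types (f g h : dual M) (a b : R).

HB.instance Definition _ := gen_eqMixin (dual M).
HB.instance Definition _ := gen_choiceMixin (dual M).

Definition dual_zero : dual M := (\0 : M -> R^o).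
Definition dual_opp f : dual M := \- (f : {linear M -> R^o}).
Definition dual_add f g : dual M :=
  (f : {linear M -> R^o}) \+ (g : {linear M -> R^o}).
Definition dual_scale a f : dual M := a \*: (f : {linear M -> R^o}).

Lemma dualP f g :
  (f : {linear M -> R^o}) =1 (g : {linear M -> R^o}) -> f = g.
Proof.
case: f g => f [[f1] [f2]] [g [[g1] [g2]]] /= /funext fg.
case: _ / fg in g1 g2 *.
by rewrite (Prop_irrelevance g1 f1) (Prop_irrelevance g2 f2).
Qed.

Lemma dual_addA : associative dual_add.
Proof. by move=> f g h; apply: dualP => x /=; rewrite addrA. Qed.
Lemma dual_addC : commutative dual_add.
Proof. by move=> f g; apply: dualP => x /=; rewrite addrC. Qed.
Lemma dual_add0 : left_id dual_zero dual_add.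
Proof. by move=> f; apply: dualP => x /=; rewrite add0r. Qed.
Lemma dual_addN : left_inverse dual_zero dual_opp dual_add.
Proof. by move=> f; apply: dualP => x /=; rewrite addNr. Qed.

HB.instance Definition _ :=
  GRing.isZmodule.Build (dual M) dual_addA dual_addC dual_add0 dual_addN.

Lemma dual_scaleA a b f : dual_scale a (dual_scale b f) = dual_scale (a * b) f.
Proof. by apply: dualP => x /=; rewrite scalerA. Qed.
Lemma dual_scale1 : left_id 1 dual_scale.
Proof. by move=> f; apply: dualP => x /=; rewrite scale1r. Qed.
Lemma dual_scaleDr : right_distributive dual_scale +%R.
Proof. by move=> a f g; apply: dualP => x /=; rewrite scalerDr. Qed.
Lemma dual_scaleDl f : {morph dual_scale^~ f : a b / a + b}.
Proof. by move=> a b; apply: dualP => x /=; rewrite scalerDl. Qed.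

HB.instance Definition _ := GRing.Zmodule_isLmodule.Build R (dual M)
  dual_scaleA dual_scale1 dual_scaleDr dual_scaleDl.

End DualModule.

Section Modules.
Variable R : comNzRingType.

Definition projective (P : lmodType R) : Prop :=
  forall (A B : lmodType R) (g : {linear A -> B}) (f : {linear P -> B}),
    surjective g -> exists h : {linear P -> A}, g \o h =1 f.

Definition finitely_generated (M : lmodType R) : Prop :=
  exists (n : nat) (g : 'I_n -> M),
    forall x, exists c : 'I_n -> R, x = \sum_(i < n) c i *: g i.

(* There is an exact sequence R^m -> R^n -> M -> 0. *)
Definition finitely_presented (M : lmodType R) : Prop :=
  exists (m n : nat) (f : {linear 'rV[R]_m -> 'rV[R]_n})
         (g : {linear 'rV[R]_n -> M}),
    surjective g /\ (forall v, g v = 0 <-> exists u, f u = v).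

Definition generates (M : lmodType R) (B : set M) : Prop :=
  forall x, exists (s : seq M) (c : M -> R),
    (forall b, b \in s -> B b) /\ x = \sum_(b <- s) c b *: b.

Definition independent (M : lmodType R) (B : set M) : Prop :=
  forall (s : seq M) (c : M -> R),
    uniq s -> (forall b, b \in s -> B b) ->
    \sum_(b <- s) c b *: b = 0 -> forall b, b \in s -> c b = 0.

Definition free_module (M : lmodType R) : Prop :=
  exists B : set M, generates B /\ independent B.

End Modules.

Section RestrictionOfScalars.
Variables (R S : comNzRingType) (phi : {rmorphism R -> S}).

Definition scalar_restr of {rmorphism R -> S} : Type := S.

HB.instance Definition _ := GRing.Zmodule.copy (scalar_restr phi) S.

Definition restr_scale (a : R) (x : scalar_restr phi) : scalar_restr phi :=
  phi a * (x : S).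

Lemma restr_scaleA a b x : restr_scale a (restr_scale b x) = restr_scale (a * b) x.
Proof. by rewrite /restr_scale rmorphM mulrA. Qed.
Lemma restr_scale1 : left_id 1 restr_scale.
Proof. by move=> x; rewrite /restr_scale rmorph1 mul1r. Qed.
Lemma restr_scaleDr : right_distributive restr_scale +%R.
Proof. by move=> a x y; apply: mulrDr. Qed.
Lemma restr_scaleDl x : {morph restr_scale^~ x : a b / a + b}.
Proof. by move=> a b; rewrite /restr_scale rmorphD; apply: mulrDl. Qed.

HB.instance Definition _ := GRing.Zmodule_isLmodule.Build R (scalar_restr phi)
  restr_scaleA restr_scale1 restr_scaleDr restr_scaleDl.

End RestrictionOfScalars.

Definition unit_vector (R : comNzRingType) (i : nat) : nat -> R^o :=
  fun j => (j == i)%:R.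

(* R^omega is the library's module of functions nat -> R^o, with pointwise
   operations. *)
Definition slender (R : comNzRingType) : Prop :=
  forall f : {linear (nat -> R^o) -> R^o},
    finite_set [set i : nat | f (unit_vector R i) <> 0].

Definition w_slender (R : comNzRingType) : Prop :=
  exists (S : comNzRingType) (phi : {rmorphism R -> S}),
    slender S /\ finitely_presented (scalar_restr phi).

Definition QS (R : comNzRingType) : Prop :=
  forall M : lmodType R, finitely_generated M -> projective M -> free_module M.

Record is_ideal (R : comNzRingType) (I : set R) : Prop := IsIdeal {
  ideal0 : I 0;
  idealD : forall x y, I x -> I y -> I (x + y);
  idealM : forall a x, I x -> I (a * x) }.

Definition noetherian (R : comNzRingType) : Prop :=
  forall I : set R, is_ideal I ->
    exists (n : nat) (g : 'I_n -> R),
      forall x, I x <-> exists c : 'I_n -> R, x = \sum_(i < n) c i * g i.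

Definition connected_ring (R : comNzRingType) : Prop :=
  forall e : R, e * e = e -> e = 0 \/ e = 1.

(* A ring isomorphism from R onto a finite product of connected Noetherian
   rings, given by its coordinate homomorphisms. For Noetherian R such a
   decomposition exists and is unique up to isomorphism and reordering of the
   factors, so quantifying over it existentially or universally in the three
   notions below makes no difference. *)
Record decomposition (R : comNzRingType) := Decomposition {
  ncomponents : nat;
  component : 'I_ncomponents -> comNzRingType;
  component_proj : forall k, {rmorphism R -> component k};
  component_proj_bij :
    bijective (fun x : R => (fun k => component_proj k x));
  component_connected : forall k, connected_ring (component k);
  component_noetherian : forall k, noetherian (component k) }.

Definition s_slender (R : comNzRingType) : Prop :=
  exists D : decomposition R, forall k, w_slender (component (d := D) k).

Definition t_slender (R : comNzRingType) : Prop :=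
  exists D : decomposition R, exists k, slender (component (d := D) k).

Definition p_slender (R : comNzRingType) : Prop :=
  exists D : decomposition R,
    forall k, slender (component (d := D) k) /\ QS (component (d := D) k).

(* Main.v *)
(* The heart of the matter is Bass's theorem: over a connected Noetherian ring a
   projective module [P] that is not finitely generated is free. If [P] is
   countably generated, with coordinates [f_i] in a free module, the ideals
   generated by the [n]-minors of the matrices [(f_i (x_j))] are idempotent
   (Cauchy-Binet), hence [0] or [R]; as [P] is not finitely generated they are all
   [R], so [P] is never of the form [I P + (finitely generated)] with [I] proper.
   This gives, far out in the coordinates, elements of content [R], hence a
   surjection from [P] onto a free module of countable rank, and the Eilenberg
   swindle makes [P] free. Arbitrary [P] follow by Kaplansky's devissage and Zorn's
   lemma.

   Duals of free modules are powers [R^I]. A linear map [S^K -> S^I] over a slender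
   ring has only finitely many nonzero values on unit vectors in each coordinate,
   so that an injective one forces [#|K| <= #|I|] (for finite [I] this is the strong
   rank condition, from Cayley-Hamilton). An isomorphism [R^K = R^I] induces
   [S^K = S^I] for every finitely presented [S], which covers w-slender rings.
   Finally everything decomposes along the connected components of [R]. *)

Require Import Defs.
From HB Require Import structures.
From mathcomp Require Import all_boot all_order all_algebra perm.
From mathcomp Require Import boolp classical_sets functions cardinality.

Set Implicit Arguments.
Unset Strict Implicit.
Unset Printing Implicit Defensive.

Import GRing.Theory.

Local Open Scope classical_set_scope.
Local Open Scope card_scope.
Local Open Scope ring_scope.

(** * Modules, spans and direct summands *)

(** Zorn's lemma on its own only reaches a free module plus a finitely generated one: once the
    remaining quotient is finitely generated, the construction stops. A countably generated summand
    that is not finitely generated is therefore set aside beforehand; together with the leftover it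
    is again countably generated and not finitely generated, hence free. The three notions of
    slenderness mirror what each argument can carry. Isomorphic duals recover a finitely generated
    projective module by reflexivity, but an injection of duals need not yield a surjection: for a
    non-principal ideal [Q] of a Dedekind domain [R], the dual of [Q] embeds in [R] while [R] does
    not map onto [Q]. QS rules this out by making such modules free. Base change of [R^K -> R^I]
    along a finitely presented [R -> S] is a map of cokernels, which keeps inverses and may lose
    injectivity, so w-slenderness serves isomorphisms. For free modules the index set is the same
    over all components, so a single slender one suffices to compare ranks. *)

Definition mk_linear (R : comNzRingType) (M N : lmodType R) (f : M -> N)
    (hf : linear f) : {linear M -> N} :=
  HB.pack f (GRing.isLinear.Build R M N *:%R f hf).

Lemma mk_linearE (R : comNzRingType) (M N : lmodType R) (f : M -> N)
  (hf : linear f) x : mk_linear hf x = f x.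
Proof. by []. Qed.

Section Span.
Variables (R : comNzRingType) (M : lmodType R).
Implicit Types (S X Y : set M).

Record submodule S : Prop := Submodule {
  submod0 : S 0;
  submodZD : forall a x y, S x -> S y -> S (a *: x + y) }.

Lemma submodD S x y : submodule S -> S x -> S y -> S (x + y).
Proof. by move=> hS Sx Sy; rewrite -[x]scale1r; apply: submodZD. Qed.

Lemma submodZ S a x : submodule S -> S x -> S (a *: x).
Proof. by move=> hS Sx; rewrite -[_ *: _]addr0; apply: submodZD => //; apply: submod0. Qed.

Lemma submodN S x : submodule S -> S x -> S (- x).
Proof. by move=> hS Sx; rewrite -scaleN1r; apply: submodZ. Qed.

Lemma submodB S x y : submodule S -> S x -> S y -> S (x - y).
Proof. by move=> hS Sx Sy; apply: submodD => //; apply: submodN. Qed.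

Lemma submod_sum S (I : Type) (r : seq I) (P : pred I) (F : I -> M) :
  submodule S -> (forall i, P i -> S (F i)) -> S (\sum_(i <- r | P i) F i).
Proof.
move=> hS hF; elim/big_ind: _ => //; first exact: submod0.
by move=> x y; apply: submodD.
Qed.

(** Impredicative on purpose: induction on membership is then [lspan_min], free of finite sums.
    Coefficients are recovered by [lspan_seqP] when needed. *)
Definition lspan X : set M := [set x | forall S, submodule S -> X `<=` S -> S x].

Lemma lspan_submodule X : submodule (lspan X).
Proof.
split=> [S hS _|a x y hx hy S hS XS]; first exact: submod0.
by apply: submodZD => //; [apply: hx | apply: hy].
Qed.

Lemma lspan0 X : lspan X 0.
Proof. exact: submod0 (lspan_submodule X). Qed.

Lemma lspanZD X a x y : lspan X x -> lspan X y -> lspan X (a *: x + y).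
Proof. exact: submodZD (lspan_submodule X) _ _ _. Qed.

Lemma lspanD X x y : lspan X x -> lspan X y -> lspan X (x + y).
Proof. exact: submodD (lspan_submodule X). Qed.

Lemma lspanB X x y : lspan X x -> lspan X y -> lspan X (x - y).
Proof. exact: submodB (lspan_submodule X). Qed.

Lemma lspanZ X a x : lspan X x -> lspan X (a *: x).
Proof. exact: submodZ (lspan_submodule X). Qed.

Lemma lspan_sum X (I : Type) (r : seq I) (P : pred I) (F : I -> M) :
  (forall i, P i -> lspan X (F i)) -> lspan X (\sum_(i <- r | P i) F i).
Proof. exact: submod_sum (lspan_submodule X). Qed.

Lemma sub_lspan X : X `<=` lspan X.
Proof. by move=> x Xx S _; apply. Qed.

Lemma lspan_min X S : submodule S -> X `<=` S -> lspan X `<=` S.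
Proof. by move=> hS XS x; apply. Qed.

Lemma lspan_mono X Y : X `<=` Y -> lspan X `<=` lspan Y.
Proof.
move=> XY; apply: lspan_min; first exact: lspan_submodule.
exact: subset_trans XY (@sub_lspan Y).
Qed.

Lemma lspan_seqP (l : seq M) x : lspan [set` l] x ->
  exists c : nat -> R, x = \sum_(i < size l) c i *: l`_i.
Proof.
move: x; apply: lspan_min => [|y /= yl]; last first.
  exists (fun i => (i == index y l)%:R); move: (yl); rewrite -index_mem => il.
  rewrite (bigD1 (Ordinal il)) //= eqxx scale1r nth_index // big1 ?addr0 //.
  by move=> i; rewrite -val_eqE /= => /negbTE ->; rewrite scale0r.
split; first by exists (fun=> 0); rewrite big1 // => i _; rewrite scale0r.
move=> a _ _ [c ->] [d ->]; exists (fun i => a * c i + d i).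
rewrite scaler_sumr -big_split /=; apply: eq_bigr => i _.
by rewrite scalerDl scalerA.
Qed.

Definition fin_gen := exists l : seq M, forall x, lspan [set` l] x.

Definition cnt_gen := exists2 X : set M, countable X & forall x, lspan X x.

Lemma fin_gen_cg : fin_gen -> cnt_gen.
Proof.
by case=> l hl; exists [set` l] => //; exact/finite_set_countable/finite_seq.
Qed.

End Span.

Lemma lspan_image (R : comNzRingType) (M N : lmodType R) (f : {linear M -> N})
  (X : set M) (Y : set N) x :
  lspan X x -> (forall y, X y -> lspan Y (f y)) -> lspan Y (f x).
Proof.
move=> hx h; move: x hx; apply: (@lspan_min _ _ X (f @^-1` lspan Y)) => //=.
split=> [|a x y hx hy] /=; first by rewrite linear0; apply: lspan0.
by rewrite linearP; apply: lspanZD.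
Qed.

Lemma fin_gen_surj (R : comNzRingType) (M N : lmodType R) (f : {linear M -> N}) :
  surjective f -> fin_gen M -> fin_gen N.
Proof.
move=> sf [l hl]; exists [seq f x | x <- l] => y; have [x <-] := sf y.
apply: (lspan_image (hl x)) => z /= zl; apply: sub_lspan => /=.
exact: map_f.
Qed.

Lemma fin_genP (R : comNzRingType) (M : lmodType R) : fin_gen M <-> finitely_generated M.
Proof.
split=> [[l hl]|[n [g hg]]].
  exists (size l), (fun i => l`_i) => x; have [c ->] := lspan_seqP (hl x).
  by exists (fun i => c i).
exists [seq g i | i <- enum 'I_n] => x; have [c ->] := hg x.
apply: lspan_sum => i _; apply: lspanZ.
by apply: sub_lspan => /=; apply: map_f; rewrite mem_enum.
Qed.

Section Iso.
Variable R : comNzRingType.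
Implicit Types M N L : lmodType R.

Lemma isoI M N (f : {linear M -> N}) (g : {linear N -> M}) :
  cancel f g -> cancel g f -> isomorphic M N.
Proof. by move=> fK gK; exists f; exists g. Qed.

Lemma isoP M N : isomorphic M N ->
  exists (f : {linear M -> N}) (g : {linear N -> M}), cancel f g /\ cancel g f.
Proof.
case=> f [g fK gK]; have lg : linear g.
  by move=> a x y; apply: (can_inj fK); rewrite linearP !gK.
by exists f, (mk_linear lg).
Qed.

Lemma iso_refl M : isomorphic M M.
Proof. by exists idfun; exists id. Qed.

Lemma iso_sym M N : isomorphic M N -> isomorphic N M.
Proof. by move=> /isoP[f [g [fK gK]]]; apply: (isoI gK fK). Qed.

Lemma iso_trans M N L : isomorphic M N -> isomorphic N L -> isomorphic M L.
Proof.
move=> [f bf] [g bg]; exists (g \o f : {linear M -> L}).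
exact: bij_comp.
Qed.

Lemma bij_iso M N (f : {linear M -> N}) :
  injective f -> surjective f -> isomorphic M N.
Proof.
move=> fi fs; have [g gK] := choice fs.
by exists f; exists g => // x; apply: fi; rewrite gK.
Qed.

Lemma iso_prod M M' N N' : isomorphic M M' -> isomorphic N N' ->
  isomorphic (M * N)%type (M' * N')%type.
Proof.
move=> /isoP[f [f' [fK f'K]]] /isoP[g [g' [gK g'K]]].
have lh : linear ((fun x => (f x.1, g x.2)) : M * N -> M' * N').
  by move=> a [x1 x2] [y1 y2]; rewrite /= !linearP.
exists (mk_linear lh); exists (fun x => (f' x.1, g' x.2)).
  by move=> [x y] /=; rewrite fK gK.
by move=> [x y] /=; rewrite f'K g'K.
Qed.

Lemma iso_prodA M N L : isomorphic (M * (N * L))%type ((M * N) * L)%type.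
Proof.
have lh : linear ((fun x => ((x.1, x.2.1), x.2.2)) : M * (N * L) -> (M * N) * L).
  by move=> a [x1 [x2 x3]] [y1 [y2 y3]].
by exists (mk_linear lh); exists (fun x => (x.1.1, (x.1.2, x.2))) => [[? []]|[[]]].
Qed.

Lemma iso_prodC M N : isomorphic (M * N)%type (N * M)%type.
Proof.
have lh : linear ((fun x => (x.2, x.1)) : M * N -> N * M).
  by move=> a [x1 x2] [y1 y2].
by exists (mk_linear lh); exists (fun x => (x.2, x.1)) => [[]|[]].
Qed.

End Iso.

Section SubType.
Variables (R : comNzRingType) (M : lmodType R) (S : set M) (hS : submodule S).

(** Indexed by the proof of [submodule S], so that structure inference can attach the closure
    properties to the predicate. *)
Definition in_submod of submodule S : {pred M} := fun x => `[< S x >].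

Lemma in_submod_closed : subsemimod_closed (in_submod hS).
Proof.
split; first split.
- by apply/asboolP; apply: submod0.
- by move=> x y /asboolP Sx /asboolP Sy; apply/asboolP; apply: submodD.
- by move=> a x /asboolP Sx; apply/asboolP; apply: submodZ.
Qed.

HB.instance Definition _ :=
  GRing.isSubSemiModClosed.Build R M (in_submod hS) in_submod_closed.

Record subM : Type := SubM { subM_val :> M; _ : subM_val \in in_submod hS }.

HB.instance Definition _ := [isSub for subM_val].
HB.instance Definition _ := [Choice of subM by <:].
HB.instance Definition _ := [SubChoice_isSubLmodule of subM by <:].

Lemma subMP (x : subM) : S (val x).
Proof. by have /asboolP := valP x. Qed.

Definition toSub x (Sx : S x) : subM := SubM (asboolT Sx : x \in in_submod hS).

End SubType.

(** * Finitely supported functions and projective modules *)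

Section FinSupp.
Variable R : comNzRingType.

Definition finsupp (I : choiceType) (A : lmodType R) : set (I -> A) :=
  [set v | finite_set [set i | v i <> 0]].

Lemma finsupp_submodule (I : choiceType) (A : lmodType R) :
  submodule (@finsupp I A).
Proof.
split=> [|a v w fv fw]; first by apply: (sub_finite_set _ (finite_set0 I)) => i /=.
rewrite /finsupp /=; apply: (sub_finite_set _ (_ : finite_set
  ([set i | v i <> 0] `|` [set i | w i <> 0]))); last by rewrite finite_setU.
move=> i /= h; apply/not_andP => -[vi wi]; apply: h.
by rewrite /GRing.scale /GRing.add /= vi wi scaler0 addr0.
Qed.

(** For [A := R^o] this is the free module on [I]; general coefficients make room for
    [fs nat (fs nat R^o)], on which the swindle runs. *)
Definition fs (I : choiceType) (A : lmodType R) : lmodType R :=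
  subM (@finsupp_submodule I A).

Section Basic.
Variables (I : choiceType) (A : lmodType R).
Implicit Types (v w : fs I A) (i : I).

Definition fcoef v i : A := (val v : I -> A) i.

Lemma fcoef_finite v : finite_set [set i | fcoef v i <> 0].
Proof. exact: subMP v. Qed.

Definition mk_fs (v : I -> A) (fv : finite_set [set i | v i <> 0]) : fs I A :=
  toSub (@finsupp_submodule I A) fv.

Lemma fcoef_mk (v : I -> A) (fv : finite_set [set i | v i <> 0]) i :
  fcoef (mk_fs fv) i = v i.
Proof. by []. Qed.

Lemma fs_ext v w : fcoef v =1 fcoef w -> v = w.
Proof. by move=> vw; apply: val_inj; apply: funext. Qed.

Lemma fcoef0 i : fcoef 0 i = 0. Proof. by []. Qed.

Lemma fcoefP i a v w : fcoef (a *: v + w) i = a *: fcoef v i + fcoef w i.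
Proof. by []. Qed.

Lemma fcoefB i v w : fcoef (v - w) i = fcoef v i - fcoef w i.
Proof. by []. Qed.

Lemma fcoefZ i a v : fcoef (a *: v) i = a *: fcoef v i.
Proof. by []. Qed.

Lemma fcoef_sum (J : Type) (r : seq J) (P : pred J) (F : J -> fs I A) i :
  fcoef (\sum_(j <- r | P j) F j) i = \sum_(j <- r | P j) fcoef (F j) i.
Proof. exact: (big_morph (fcoef^~ i)). Qed.

Lemma fsupp_ex v : exists s : seq I, uniq s /\ forall i, (i \in s) = (fcoef v i != 0).
Proof.
have /finite_seqP[s hs] := fcoef_finite v; exists (undup s); rewrite undup_uniq.
split=> // i; rewrite mem_undup; have /= hi := congr1 (fun X => X i) hs.
by apply/idP/idP => [|/eqP]; [rewrite -hi => /eqP | rewrite hi].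
Qed.

Definition fsupp v : seq I := projT1 (cid (fsupp_ex v)).

Lemma fsupp_uniq v : uniq (fsupp v).
Proof. by rewrite /fsupp; case: cid => s []. Qed.

Lemma mem_fsupp v i : (i \in fsupp v) = (fcoef v i != 0).
Proof. by rewrite /fsupp; case: cid => s []. Qed.

End Basic.

Definition single (I : choiceType) (i : I) : fs I R^o.
Proof.
apply: (@mk_fs I R^o (fun j => (j == i)%:R)).
apply: (sub_finite_set _ (finite_set1 i)) => j /=.
by case: eqP => // _ []; rewrite mulr0n.
Defined.

Lemma singleE (I : choiceType) (i j : I) : fcoef (single i) j = (j == i)%:R.
Proof. by []. Qed.

Section Lift.
Variables (I : choiceType) (M : lmodType R).

Definition fs_sum (p : I -> M) (v : fs I R^o) : M :=
  \sum_(i <- fsupp v) (fcoef v i : R) *: p i.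

Lemma fs_sumE (p : I -> M) (v : fs I R^o) (s : seq I) :
  uniq s -> (forall i, fcoef v i <> 0 -> i \in s) ->
  fs_sum p v = \sum_(i <- s) (fcoef v i : R) *: p i.
Proof.
move=> us vs; rewrite [RHS](bigID (fun i => fcoef v i != 0)) /=.
rewrite [X in _ + X]big1 ?addr0 => [|i /negbNE/eqP ->]; last by rewrite scale0r.
rewrite -big_filter; apply: perm_big; apply: uniq_perm.
- exact: fsupp_uniq.
- exact: filter_uniq.
move=> i; rewrite mem_filter mem_fsupp; case: eqP => //= vi.
by symmetry; apply: vs.
Qed.

Lemma fs_sum_linear (p : I -> M) : linear (fs_sum p).
Proof.
move=> a v w; pose s := undup (fsupp v ++ fsupp w).
have us : uniq s by exact: undup_uniq.
rewrite (fs_sumE p (v := v) us) ?(fs_sumE p (v := w) us) ?(fs_sumE p us).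
- rewrite scaler_sumr -big_split; apply: eq_bigr => i _ /=.
  by rewrite fcoefP scalerDl scalerA.
- move=> i; rewrite mem_undup mem_cat !mem_fsupp; apply: contra_notT.
  by rewrite negb_or !negbK fcoefP => /andP[/eqP -> /eqP ->]; rewrite scaler0 addr0.
- by move=> i /eqP; rewrite mem_undup mem_cat !mem_fsupp => ->; rewrite orbT.
- by move=> i /eqP; rewrite mem_undup mem_cat !mem_fsupp => ->.
Qed.

Definition fs_lift (p : I -> M) : {linear fs I R^o -> M} :=
  mk_linear (fs_sum_linear p).

Lemma fs_liftE (p : I -> M) (v : fs I R^o) (s : seq I) :
  uniq s -> (forall i, fcoef v i <> 0 -> i \in s) ->
  fs_lift p v = \sum_(i <- s) (fcoef v i : R) *: p i.
Proof. exact: fs_sumE. Qed.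

Lemma fs_lift_supp (p : I -> M) (v : fs I R^o) :
  fs_lift p v = \sum_(i <- fsupp v) (fcoef v i : R) *: p i.
Proof. by []. Qed.

Lemma fs_lift_single (p : I -> M) i : fs_lift p (single i) = p i.
Proof.
rewrite (@fs_liftE p _ [:: i]) // => [|j]; first by rewrite big_seq1 singleE eqxx scale1r.
by rewrite singleE inE; case: eqP.
Qed.

End Lift.

Lemma fs_lift_single_id (I : choiceType) (v : fs I R^o) : fs_lift (@single I) v = v.
Proof.
apply: fs_ext => j; rewrite fs_lift_supp fcoef_sum.
have [vj|vj] := boolP (j \in fsupp v).
  rewrite (bigD1_seq j) ?fsupp_uniq //= big1 => [|i ij].
    by rewrite fcoefZ singleE eqxx addr0 [_ *: _]mulr1.
  by rewrite fcoefZ singleE eq_sym (negbTE ij) scaler0.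
rewrite big_seq big1 => [|i vi]; first by move: vj; rewrite mem_fsupp => /negbNE/eqP.
rewrite fcoefZ singleE; case: eqP => [ji|]; last by rewrite scaler0.
by rewrite ji vi in vj.
Qed.

Lemma fs_lin_ext (I : choiceType) (M : lmodType R) (f g : {linear fs I R^o -> M}) :
  (forall i, f (single i) = g (single i)) -> f =1 g.
Proof.
move=> h v; rewrite -(fs_lift_single_id v) fs_lift_supp !linear_sum.
by apply: eq_bigr => i _; rewrite !linearZ /= h.
Qed.

Lemma fs_lift_span (I : choiceType) (M : lmodType R) (p : I -> M) (v : fs I R^o)
  (X : set M) : (forall i, fcoef v i <> 0 -> lspan X (p i)) -> lspan X (fs_lift p v).
Proof.
move=> h; rewrite fs_lift_supp big_seq; apply: lspan_sum => i; rewrite mem_fsupp => /eqP vi.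
by apply: lspanZ; apply: h.
Qed.

Lemma submod_range (M N : lmodType R) (f : {linear M -> N}) :
  submodule (range f).
Proof.
split=> [|a _ _ [x _ <-] [y _ <-]]; first by exists 0; rewrite ?linear0.
by exists (a *: x + y); rewrite ?linearP.
Qed.

Lemma cnt_gen_lift (M : lmodType R) : cnt_gen M ->
  exists q : {linear fs nat R^o -> M}, surjective q.
Proof.
case=> X /pfcard_geP[X0|[f]] hX.
  exists (fs_lift (fun=> 0)) => x; exists 0; rewrite linear0.
  apply: esym; apply: (hX x [set 0]) => [|y]; last by rewrite X0.
  by split=> //= a y z -> ->; rewrite scaler0 addr0.
exists (fs_lift f) => x.
suff [v _ <-] : range (fs_lift f) x by exists v.
apply: hX; first exact: submod_range.
by move=> y /'surj_f[n _ <-]; exists (single n); rewrite // fs_lift_single.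
Qed.

End FinSupp.

Section Projective.
Variable R : comNzRingType.
Implicit Types M N : lmodType R.

Lemma projective_fs (I : choiceType) : projective (fs I R^o).
Proof.
move=> A B g f sg; have /choice[a ha] : forall i : I, exists x, g x = f (single R i).
  by move=> i; apply: sg.
exists (fs_lift a); apply: (@fs_lin_ext _ _ _ (g \o fs_lift a : {linear _ -> _}) f) => i.
exact: etrans (congr1 g (fs_lift_single a i)) (ha i).
Qed.

Lemma projective_section M N (f : {linear N -> M}) : projective M ->
  surjective f -> exists s : {linear M -> N}, cancel s f.
Proof. by move=> pM sf; have [s hs] := pM _ _ f idfun sf; exists s. Qed.

Lemma projective_retract M N (i : {linear N -> M}) (r : {linear M -> N}) :
  cancel i r -> projective M -> projective N.
Proof.
move=> ir pM A B g f sg; have [h hh] := pM _ _ g (f \o r : {linear M -> B}) sg.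
exists (h \o i : {linear N -> A}) => x /=.
by have /= -> := hh (i x); rewrite ir.
Qed.

Lemma iso_projective M N : isomorphic M N -> projective M -> projective N.
Proof. by move=> /isoP[f [g [fK gK]]]; apply: projective_retract gK. Qed.

End Projective.

Section Idempotent.
Variables (R : comNzRingType) (M : lmodType R) (e : {linear M -> M}).
Hypothesis ee : forall x, e (e x) = e x.

Lemma im_submodule : submodule [set x | e x = x].
Proof. by split=> [|a x y /= ex ey]; rewrite /= ?linear0 // linearP ex ey. Qed.

Lemma ker_submodule : submodule [set x | e x = 0].
Proof.
by split=> [|a x y /= ex ey]; rewrite /= ?linear0 // linearP ex ey /= scaler0 addr0.
Qed.

Definition imM : lmodType R := subM im_submodule.
Definition kerM : lmodType R := subM ker_submodule.

Definition to_im (x : M) : imM := toSub im_submodule (ee x).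

Lemma kerE x : e (x - e x) = 0.
Proof. by rewrite linearB ee subrr. Qed.

Definition to_ker (x : M) : kerM := toSub ker_submodule (kerE x).

Lemma to_im_linear : linear to_im.
Proof. by move=> a x y; apply: val_inj; rewrite /= linearP. Qed.

Lemma to_ker_linear : linear to_ker.
Proof.
by move=> a x y; apply: val_inj; rewrite /= linearP /= scalerBr opprD addrACA.
Qed.

Definition im_proj : {linear M -> imM} := mk_linear to_im_linear.
Definition ker_proj : {linear M -> kerM} := mk_linear to_ker_linear.
Definition im_incl : {linear imM -> M} := val.
Definition ker_incl : {linear kerM -> M} := val.

Lemma im_inclK : cancel im_incl im_proj.
Proof. by move=> x; apply: val_inj => /=; apply: (subMP x). Qed.

Lemma ker_inclK : cancel ker_incl ker_proj.
Proof.
by move=> x; apply: val_inj => /=; have /= -> := subMP x; rewrite subr0.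
Qed.

Lemma idem_split : isomorphic M (imM * kerM)%type.
Proof.
have hl : linear (fun x => (im_proj x, ker_proj x)) by move=> a x y; rewrite !linearP.
exists (mk_linear hl); exists (fun y => im_incl y.1 + ker_incl y.2) => [x|[x y]] /=.
  by rewrite addrC subrK.
rewrite -[X in (X, _)]/(im_proj _) -[X in (_, X)]/(ker_proj _).
have ex : e (val x) = val x := subMP x.
have ey : e (val y) = 0 := subMP y.
by congr (_, _); apply: val_inj; rewrite /= linearD ex ey addr0 // addrAC subrr add0r.
Qed.

Lemma projective_im : projective M -> projective imM.
Proof. exact: projective_retract im_inclK. Qed.

Lemma projective_ker : projective M -> projective kerM.
Proof. exact: projective_retract ker_inclK. Qed.

End Idempotent.

(** * Free modules and the Eilenberg swindle *)

Section FsIso.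
Variable R : comNzRingType.

Section Comp.
Variables (I K : choiceType) (A : lmodType R) (h : K -> I) (hi : injective h).

Lemma fs_comp_finite (v : fs I A) : finite_set [set k | fcoef v (h k) <> 0].
Proof.
by apply: (@finite_preimage _ _ _ h _ (fcoef_finite v)) => x y _ _; apply: hi.
Qed.

Lemma fs_comp_linear : linear (fun v : fs I A => mk_fs (fs_comp_finite v)).
Proof. by move=> a v w; apply: fs_ext. Qed.

Definition fs_comp : {linear fs I A -> fs K A} := mk_linear fs_comp_linear.

Lemma fs_compE v k : fcoef (fs_comp v) k = fcoef v (h k).
Proof. by []. Qed.

End Comp.

Lemma fs_comp_single (I K : choiceType) (h : K -> I) (hi : injective h) (k : K) :
  fs_comp R^o hi (single R (h k)) = single R k.
Proof. by apply: fs_ext => j; rewrite fs_compE !singleE (inj_eq hi). Qed.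

Lemma fs_comp_lift (I K : choiceType) (h : K -> I) (hi : injective h)
  (w : fs K R^o) : fs_comp R^o hi (fs_lift (fun k => single R (h k)) w) = w.
Proof.
apply: (@fs_lin_ext R K _ (fs_comp R^o hi \o fs_lift _ : {linear _ -> _}) idfun) => k.
exact: etrans (congr1 _ (fs_lift_single _ k)) (fs_comp_single hi k).
Qed.

Lemma fs_comp_surj (I K : choiceType) (h : K -> I) (hi : injective h) :
  surjective (fs_comp R^o hi).
Proof. by move=> w; exists (fs_lift (fun k => single R (h k)) w); apply: fs_comp_lift. Qed.

Lemma fs_reindex (I K : choiceType) (h : K -> I) :
  bijective h -> isomorphic (fs I R^o) (fs K R^o).
Proof.
move=> bh; have hi := bij_inj bh; apply: (bij_iso (f := fs_comp R^o hi)).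
  move=> v w vw; apply: fs_ext => i; case: bh => g _ gK.
  by rewrite -(gK i) -!(fs_compE hi) vw.
exact: fs_comp_surj.
Qed.

Lemma inl_inj (T U : Type) : injective (@inl T U). Proof. by move=> x y []. Qed.
Lemma inr_inj (T U : Type) : injective (@inr T U). Proof. by move=> x y []. Qed.

Lemma fs_sum_prod (I K : choiceType) :
  isomorphic (fs (I + K)%type R^o) (fs I R^o * fs K R^o)%type.
Proof.
pose l := fs_comp R^o (@inl_inj I K); pose r := fs_comp R^o (@inr_inj I K).
have hl : linear (fun v => (l v, r v)) by move=> a x y; rewrite !linearP.
apply: (bij_iso (f := mk_linear hl)).
  move=> v w vw; apply: fs_ext => -[i|k].
    exact: (congr1 (fun x => fcoef x.1 i) vw).
  exact: (congr1 (fun x => fcoef x.2 k) vw).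
move=> [v w]; pose jl := fs_lift (fun i => single R (inl i : I + K)).
pose jr := fs_lift (fun i => single R (inr i : I + K)).
have lr x : l (jr x) = 0.
  apply: (@fs_lin_ext R _ _ (l \o jr : {linear _ -> _}) \0) => k.
  apply: etrans (congr1 _ (fs_lift_single _ k)) _.
  by apply: fs_ext => j; rewrite fs_compE singleE.
have rl x : r (jl x) = 0.
  apply: (@fs_lin_ext R _ _ (r \o jl : {linear _ -> _}) \0) => k.
  apply: etrans (congr1 _ (fs_lift_single _ k)) _.
  by apply: fs_ext => j; rewrite fs_compE singleE.
exists (jl v + jr w) => /=; rewrite -[X in (X, _)]/(l _) -[X in (_, X)]/(r _).
by rewrite !linearD lr rl addr0 add0r /l /r /jl /jr !fs_comp_lift.
Qed.

Lemma pair_inj (I J : Type) (i : I) : injective (fun j : J => (i, j)).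
Proof. by move=> x y []. Qed.

Section Curry.
Variables (I J : choiceType) (A : lmodType R).

Lemma fs_curry_finite (v : fs (I * J)%type A) :
  finite_set [set i | fs_comp A (@pair_inj I J i) v <> 0].
Proof.
apply: (sub_finite_set _ (finite_image fst (fcoef_finite v))) => i /= h.
apply: contrapT => hn; apply: h; apply: fs_ext => j.
rewrite fs_compE fcoef0; apply: contrapT => vij; apply: hn.
by exists (i, j).
Qed.

Lemma fs_curry_linear : linear (fun v => mk_fs (fs_curry_finite v)).
Proof. by move=> a v w; apply: fs_ext => i; apply: fs_ext. Qed.

Lemma fs_curry : isomorphic (fs (I * J)%type A) (fs I (fs J A)).
Proof.
apply: (bij_iso (f := mk_linear fs_curry_linear)).
  move=> v w vw; apply: fs_ext => -[i j].
  exact: (congr1 (fun x => fcoef (fcoef x i) j) vw).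
move=> w.
have fw : finite_set [set ij : I * J | fcoef (fcoef w ij.1) ij.2 <> 0].
  apply: (sub_finite_set _ (finite_setXR (fcoef_finite w)
    (fun i _ => fcoef_finite (fcoef w i)))) => -[i j] /= wij; split=> //=.
  by move=> wi; apply: wij; rewrite wi.
by exists (mk_fs fw); apply: fs_ext => i; apply: fs_ext => j.
Qed.

End Curry.

Lemma fs_nat_self : isomorphic (fs nat R^o) (fs nat (fs nat R^o)).
Proof.
apply: iso_trans (fs_curry nat nat R^o).
have /card_set_bijP[f] := card_nat2; rewrite setTT_bijective => bf.
exact: fs_reindex bf.
Qed.

End FsIso.

Section Swindle.
Variables (R : comNzRingType) (M : lmodType R).
Let F := fs nat R^o.
Variables (s : {linear M -> F}) (q : {linear F -> M}) (sq : cancel s q).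
Variables (G : {linear M -> fs nat F}) (X : {linear fs nat F -> M}) (XG : cancel X G).

(** Let [K] be the kernel of [G], so that [M = K + fs nat F]. The maps [nu] and [iota] exhibit [K]
    as a summand of [F] as well: [iota] after [nu] is the projection of [M] onto [K], and [E] is an
    idempotent of [F] with image isomorphic to [K]. *)
Let nu x := s (x - X (G x)).
Let iota v := q v - X (G (q v)).
Let E v := nu (q v).

Let nu_linear : linear nu.
Proof.
move=> a x y; rewrite /nu -linearP; congr (s _).
by rewrite (linearP G) (linearP X) scalerBr opprD addrACA.
Qed.
Let iota_linear : linear iota.
Proof.
by move=> a x y; rewrite /iota (linearP q) (linearP G) (linearP X) scalerBr opprD addrACA.
Qed.
Let nuL := mk_linear nu_linear.
Let iotaL := mk_linear iota_linear.
Let EL : {linear F -> F} := (nuL \o q).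

Let GX0 x : G (x - X (G x)) = 0. Proof. by rewrite linearB XG subrr. Qed.
Let nuX w : nu (X w) = 0. Proof. by rewrite /nu XG subrr linear0. Qed.
Let Giota v : G (iota v) = 0. Proof. exact: GX0. Qed.
Let nu_iota v : nu (iota v) = E v.
Proof. by rewrite /iota -[LHS]/(nuL _) linearB /= nuX subr0. Qed.
Let iota_nu x : iota (nu x) = x - X (G x).
Proof. by rewrite /iota /nu sq GX0 linear0 subr0. Qed.
Let iotaE v : iota (E v) = iota v.
Proof. by rewrite -nu_iota iota_nu Giota linear0 subr0. Qed.
Let Enu x : E (nu x) = nu x.
Proof. by rewrite -nu_iota iota_nu -[LHS]/(nuL _) linearB /= nuX subr0. Qed.
Let EE v : E (E v) = E v. Proof. exact: Enu. Qed.

(** With [C] the kernel of [E], each slot is [F = C + K]. The regrouping [K + (C + K) + (C + K) +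
    ... = (K + C) + (K + C) + ...] leaves the [C] part of each slot in place and moves its [K] part
    one slot up, slot 0 being filled by the summand [K] of [M]. *)
Let phi_fun x n : F :=
  if n is i.+1 then E (fcoef (G x) i) + (fcoef (G x) i.+1 - E (fcoef (G x) i.+1))
  else nu x + (fcoef (G x) 0%N - E (fcoef (G x) 0%N)).

Let E0 : E 0 = 0. Proof. exact: (linear0 EL). Qed.
Let ED v w : E (v + w) = E v + E w. Proof. exact: (linearD EL). Qed.
Let EN v : E (- v) = - E v. Proof. exact: (linearN EL). Qed.

Let phi_finite x : finite_set [set n | phi_fun x n <> 0].
Proof.
pose S := [set i | fcoef (G x) i <> 0].
have fS : finite_set S by exact: fcoef_finite.
apply: (sub_finite_set _ (_ : finite_set ([set 0%N] `|` S `|` (succn @` S)))).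
  case=> [|i] /= h; first by left; left.
  have [wi|wi] := pselect (fcoef (G x) i = 0); last by right; exists i.
  left; right => wi1; apply: h.
  by rewrite wi wi1 E0 subr0 addr0.
rewrite !finite_setU; split; last exact: finite_image.
by split=> //; apply: finite_set1.
Qed.

Let phi_linear : linear (fun x => mk_fs (phi_finite x)).
Proof.
have aux a (u v p p' r r' : F) : a *: u + v + (a *: p + p' - (a *: r + r')) =
    a *: (u + (p - r)) + (v + (p' - r')).
  by rewrite scalerDr scalerBr opprD (addrACA (a *: p)) (addrACA (a *: u)).
move=> a x y; apply: fs_ext => -[|i]; rewrite fcoefP !fcoef_mk /phi_fun.
  by rewrite [nu _](linearP nuL) linearP fcoefP [E (_ + _)](linearP EL) /= aux.
by rewrite linearP !fcoefP ![E (_ + _)](linearP EL) /= aux.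
Qed.

(** The regrouping undone: the [K] part comes back from slot [i.+1]. That of slot 0 returns to [M]
    through [iota]. *)
Let shift (v : fs nat F) i : F :=
  fcoef v i - E (fcoef v i) + E (fcoef v i.+1).

Let shift_finite v : finite_set [set i | shift v i <> 0].
Proof.
pose S := [set i | fcoef v i <> 0].
have fS : finite_set S by exact: fcoef_finite.
apply: (sub_finite_set _ (_ : finite_set (S `|` (succn @^-1` S)))).
  move=> i /= h; apply/not_andP => -[wi wi1]; apply: h.
  by rewrite /shift wi wi1 E0 subr0 addr0.
rewrite finite_setU; split=> //; apply: finite_preimage => // i j _ _.
exact: succn_inj.
Qed.

Lemma swindle : isomorphic M (fs nat F).
Proof.
exists (mk_linear phi_linear).
exists (fun v => iota (fcoef v 0%N) + X (mk_fs (shift_finite v))).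
  move=> x; rewrite mk_linearE.
  have -> : mk_fs (shift_finite (mk_fs (phi_finite x))) = G x.
    apply: fs_ext => -[|i]; rewrite fcoef_mk /shift !fcoef_mk /phi_fun.
      by rewrite !(ED, EN) !EE Enu !subrr !addr0 (addrC (nu x)) addrK subrK.
    by rewrite !(ED, EN) !EE !subrr !addr0 (addrC (E _)) addrK subrK.
  rewrite fcoef_mk /phi_fun -[iota _]/(iotaL _) linearD linearB /= !iotaE.
  by rewrite subrr addr0 iota_nu subrK.
move=> v; set y := iota _ + _; apply: fs_ext => n.
have Gy : G y = mk_fs (shift_finite v) by rewrite linearD Giota add0r XG.
have nuy : nu y = E (fcoef v 0%N).
  by rewrite /y -[LHS]/(nuL _) linearD /= nuX addr0 nu_iota.
rewrite fcoef_mk /phi_fun; case: n => [|i]; rewrite Gy ?nuy !fcoef_mk /shift !(ED, EN) !EE.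
  by rewrite subrr add0r addrK addrC subrK.
by rewrite !subrr !add0r addrK addrC subrK.
Qed.

End Swindle.

(** * Determinants and Noetherian rings *)

Section Ideals.
Variables (R : comNzRingType) (I : set R^o) (hI : submodule I).

Lemma ideal_sum (T : Type) (r : seq T) (P : pred T) (F : T -> R) :
  (forall i, P i -> I (F i)) -> I (\sum_(i <- r | P i) F i).
Proof. exact: (@submod_sum R R^o I T r P F hI). Qed.

Lemma idealM (a x : R) : I x -> I (a * x).
Proof. exact: (submodZ a hI). Qed.

Lemma idealD (x y : R) : I x -> I y -> I (x + y).
Proof. exact: (submodD hI). Qed.

End Ideals.

Section CauchyBinet.
Variable R : comNzRingType.

Lemma det_mul_expand (n m : nat) (A : 'M[R]_(n, m)) (B : 'M[R]_(m, n)) :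
  \det (A *m B) = \sum_(f : {ffun 'I_n -> 'I_m})
     (\prod_i A i (f i)) * \det (rowsub f B).
Proof.
transitivity (\sum_(s : 'S_n) \sum_(f : {ffun 'I_n -> 'I_m})
    (\prod_i A i (f i)) * ((-1) ^+ s * \prod_i B (f i) (s i))).
  apply: eq_bigr => s _; under eq_bigr do rewrite mxE.
  rewrite bigA_distr_bigA /= big_distrr /=; apply: eq_bigr => f _.
  by rewrite big_split mulrCA.
rewrite exchange_big; apply: eq_bigr => f _; rewrite -big_distrr /=; congr (_ * _).
by apply: eq_bigr => s _; congr (_ * _); apply: eq_bigr => i _; rewrite mxE.
Qed.

Lemma det_rowsub_perm (n m : nat) (f : 'I_n -> 'I_m) (B : 'M[R]_(m, n)) (s : 'S_n) :
  \det (rowsub (fun i => f (s i)) B) = (-1) ^+ s * \det (rowsub f B).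
Proof.
rewrite -det_perm -det_mulmx -row_permE; congr (\det _).
by apply/matrixP => i j; rewrite !mxE.
Qed.

(* Cauchy-Binet, stated as membership in a submodule: injective maps with the
   same image differ by a permutation, and their terms add up to a product of
   two minors. *)
Lemma det_mul_in (n m : nat) (A : 'M[R]_(n, m)) (B : 'M[R]_(m, n)) (I : set R^o) :
  submodule I ->
  (forall f : 'I_n -> 'I_m, injective f -> I (\det (colsub f A) * \det (rowsub f B))) ->
  I (\det (A *m B)).
Proof.
move=> hI IAB; rewrite det_mul_expand (bigID (fun f : {ffun _ -> _} => injectiveb f)) /=.
rewrite [X in _ + X]big1 ?addr0 => [|f /injectivePn[i [j ij fij]]]; last first.
  by rewrite (determinant_alternate ij) ?mulr0 // => k; rewrite !mxE fij.
rewrite (partition_big (fun f : {ffun _ -> _} => f @: 'I_n) predT) //=.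
apply: (ideal_sum hI) => T _.
have [f0 /andP[/injectiveP f0i /eqP f0T]|no] := pickP (fun f : {ffun 'I_n -> 'I_m} =>
    injectiveb f && (f @: 'I_n == T)); last first.
  by rewrite big_pred0 //; apply: (submod0 hI).
pose h (s : 'S_n) : {ffun 'I_n -> 'I_m} := [ffun i => f0 (s i)].
have hinj : injective h.
  move=> s t st; apply/permP => i; apply: f0i.
  by have := congr1 (fun f : {ffun _ -> _} => f i) st; rewrite !ffunE.
have hex (f : {ffun 'I_n -> 'I_m}) :
    injectiveb f && (f @: 'I_n == T) -> exists s, h s = f.
  move=> /andP[/injectiveP fi /eqP fT].
  have ex i : exists j, f0 j == f i.
    have : f i \in f0 @: 'I_n by rewrite f0T -fT imset_f.
    by case/imsetP => j _ ->; exists j.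
  pose t i := xchoose (ex i); have tE i : f0 (t i) = f i by apply/eqP/(xchooseP (ex i)).
  have ti : injective t by move=> i j tij; apply: fi; rewrite -!tE tij.
  by exists (perm ti); apply/ffunP => i; rewrite ffunE permE.
rewrite (reindex h) /=; last first.
  exists (fun f => odflt 1%g [pick s | h s == f]) => [s _|f /hex[s <-]].
    by case: pickP => [t /eqP /hinj ->|/(_ s)]; rewrite ?eqxx.
  by case: pickP => [t /eqP //|/(_ s)]; rewrite ?eqxx.
rewrite (eq_bigl predT) => [|s]; last first.
  apply/andP; split.
    by apply/injectiveP => i j; rewrite !ffunE => /f0i /perm_inj.
  apply/eqP; rewrite -f0T; apply/setP => k; apply/imsetP/imsetP => -[i _ ->].
    by exists (s i); rewrite // ffunE.
  by exists ((s^-1)%g i); rewrite // ffunE permKV.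
suff -> : \sum_(s | predT s) (\prod_i A i (h s i)) * \det (rowsub (h s) B) =
    \det (colsub f0 A) * \det (rowsub f0 B) by apply: IAB.
rewrite big_distrl /=; apply: eq_bigr => s _.
have -> : rowsub (h s) B = rowsub (fun i => f0 (s i)) B.
  by apply/matrixP => i j; rewrite !mxE ffunE.
rewrite det_rowsub_perm mulrCA mulrA; congr (_ * _ * _).
by apply: eq_bigr => i _; rewrite !mxE ffunE.
Qed.

(** Cauchy-Binet for the zero ideal, where the hypothesis is vacuous: there is no injection of
    ['I_n.+1] into ['I_n]. *)
Lemma det_mul_thin (n : nat) (A : 'M[R]_(n.+1, n)) (B : 'M[R]_(n, n.+1)) :
  \det (A *m B) = 0.
Proof.
apply: (@det_mul_in _ _ A B [set 0]) => [|f fi].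
  by split=> // a x y /= -> ->; rewrite scaler0 addr0.
by have := leq_card f fi; rewrite !card_ord ltnn.
Qed.

Lemma prod_cong (I : set R^o) (T : Type) (r : seq T) (a b : T -> R) :
  submodule I -> (forall t, I (a t - b t)) ->
  I (\prod_(t <- r) a t - \prod_(t <- r) b t).
Proof.
move=> hI ab; elim: r => [|t r IH]; first by rewrite !big_nil subrr; apply: (submod0 hI).
rewrite !big_cons; set x := \prod_(_ <- _) _; set y := \prod_(_ <- _) _.
have -> : a t * x - b t * y = a t * (x - y) + y * (a t - b t).
  by rewrite !mulrBr addrA (mulrC y) subrK (mulrC y).
by apply: (idealD hI); apply: (idealM hI).
Qed.

(** Reduction modulo [I], without forming a quotient ring. *)
Lemma det_cong (I : set R^o) (n : nat) (A B : 'M[R]_n) :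
  submodule I -> (forall i j, I (A i j - B i j)) -> I (\det A - \det B).
Proof.
move=> hI AB; rewrite /determinant -sumrB; apply: (ideal_sum hI) => s _.
by rewrite -mulrBr; apply: (idealM hI); apply: prod_cong.
Qed.

End CauchyBinet.

(** * Finiteness over a Noetherian ring, and idempotent ideals *)

Section Noetherian.
Variable R : comNzRingType.
Hypothesis hR : noetherian R.

Lemma noetherian_ideal (I : set R^o) : submodule I ->
  exists l : seq R^o, [set` l] `<=` I /\ I `<=` lspan [set` l].
Proof.
move=> hI; have idI : is_ideal (I : set R).
  split=> [|x y|a x]; first exact: (submod0 hI).
    exact: (idealD hI).
  exact: (idealM hI).
have [n [g hg]] := hR idI; exists [seq g i | i <- enum 'I_n]; split=> x.
  move=> /= /mapP[i _ ->]; apply/hg; exists (fun j => (j == i)%:R).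
  rewrite (bigD1 i) //= eqxx mul1r big1 ?addr0 // => j /negbTE ->.
  by rewrite mul0r.
move=> /hg[c ->]; apply: lspan_sum => i _; apply: (@lspanZ R R^o).
by apply: sub_lspan => /=; apply: map_f; rewrite mem_enum.
Qed.

Section Chains.
Variables (M : lmodType R) (S : nat -> set M).
Hypothesis hS : forall n, submodule (S n).
Hypothesis Smono : forall n, S n `<=` S n.+1.

Lemma chain_le m n : (m <= n)%N -> S m `<=` S n.
Proof.
move=> /subnK <-; elim: (n - m)%N => // k IH x /IH; rewrite addSn; exact: Smono.
Qed.

Lemma chain_union : submodule (\bigcup_n S n).
Proof.
split=> [|a x y [m _ Sx] [n _ Sy]]; first by exists 0%N => //; apply: submod0.
exists (maxn m n) => //; apply: submodZD => //.
  exact: chain_le (leq_maxl m n) _ Sx.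
exact: chain_le (leq_maxr m n) _ Sy.
Qed.

Lemma chain_finite (l : seq M) : [set` l] `<=` \bigcup_n S n ->
  exists n, [set` l] `<=` S n.
Proof.
elim: l => [|x l IH] h; first by exists 0%N.
have [|n hn] := IH; first by move=> y /= yl; apply: h => /=; rewrite inE yl orbT.
have [m _ Sx] : (\bigcup_n S n) x by apply: h => /=; rewrite inE eqxx.
exists (maxn m n) => y /=; rewrite inE => /orP[/eqP->|yl].
  exact: chain_le (leq_maxl m n) _ Sx.
by apply: (chain_le (leq_maxr m n)); apply: hn.
Qed.

End Chains.

(** Otherwise dependent choice builds a strictly ascending chain, while finitely many generators of
    its union already lie in one member. *)
Lemma noetherian_max (T : Type) (t0 : T) (I : T -> set R^o) :
  (forall t, submodule (I t)) -> exists t, forall u, I t `<=` I u -> I u `<=` I t.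
Proof.
move=> hI; apply: contrapT => /forallNP no.
have /choice[nx hnx] : forall t, exists u, I t `<=` I u /\ ~ (I u `<=` I t).
  by move=> t; have /existsNP[u /not_implyP[? ?]] := no t; exists u.
pose S n := I (iter n nx t0).
have Sm n : S n `<=` S n.+1 by have [] := hnx (iter n nx t0).
have hS n : submodule (S n) by exact: hI.
have [l [lS Sl]] := noetherian_ideal (chain_union hS Sm).
have [n ln] := chain_finite Sm lS.
have [_] := hnx (iter n nx t0); apply => x xn.
by apply: (lspan_min (hS n) ln); apply: Sl; exists n.+1.
Qed.

Lemma lspan_map_ex (M N : lmodType R) (f : {linear M -> N}) (l : seq M) y :
  lspan [set` map f l] y -> exists2 x, lspan [set` l] x & f x = y.
Proof.
move=> h; have [] // := h [set y | exists2 x, lspan [set` l] x & f x = y].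
- split; first by exists 0; rewrite ?linear0 //; apply: lspan0.
  move=> a _ _ [x hx <-] [z hz <-]; exists (a *: x + z); last by rewrite linearP.
  exact: lspanZD.
- by move=> _ /= /mapP[x xl ->]; exists x => //; apply: sub_lspan.
by move=> x; exists x.
Qed.

Lemma seq_lift (M N : Type) (f : M -> N) (S : M -> Prop) (m : seq N) :
  (forall i, (i < size m)%N -> exists2 x, S x & forall y0, f x = nth y0 m i) ->
  exists l : seq M, map f l = m /\ forall x0 i, (i < size l)%N -> S (nth x0 l i).
Proof.
elim: m => [|y m IH] h; first by exists [::].
have [i im|l [lm lS]] := IH; first by have [x Sx hx] := h i.+1 im; exists x.
have [x Sx hx] := h 0%N erefl.
exists (x :: l); split=> [|x0 [|i]] //=; last exact: lS.
by rewrite lm (hx y).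
Qed.

(** The image of [S] in [R^N] is finitely generated. In the induction the new coordinate is treated
    on [S'], where the earlier ones vanish: its values there form an ideal, and corrections taken
    from [S'] do not disturb the earlier coordinates. *)
Lemma noetherian_coords (M : lmodType R) (f : nat -> {linear M -> R^o}) (S : set M)
    (N : nat) : submodule S ->
  exists l : seq M, [set` l] `<=` S /\
    forall z, S z -> exists2 y, lspan [set` l] y & forall i, (i < N)%N -> f i z = f i y.
Proof.
move=> hS; elim: N => [|N [l [lS hl]]].
  by exists [::]; split=> // z _; exists 0 => //; apply: lspan0.
pose S' := [set z | S z /\ forall i, (i < N)%N -> f i z = 0].
have hS' : submodule S'.
  split=> [|a x y [Sx x0] [Sy y0]].
    by split=> [|i _]; [apply: submod0 | rewrite linear0].
  split=> [|i iN]; first exact: submodZD.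
  by rewrite linearP x0 // y0 // scaler0 addr0.
have hI : submodule (f N @` S').
  split=> [|a _ _ [x Sx <-] [y Sy <-]].
    by exists 0; [apply: submod0 | rewrite linear0].
  by exists (a *: x + y); [apply: submodZD | rewrite linearP].
have [m [mI Im]] := noetherian_ideal hI.
have [|l' [l'm l'S]] := @seq_lift _ _ (f N) S' m.
  move=> i im; have [|x Sx xi] := mI (nth 0 m i); first exact: mem_nth.
  by exists x => // y0; rewrite xi (set_nth_default y0).
have {}l'S : [set` l'] `<=` S'.
  by move=> x /= xl; rewrite -(nth_index 0 xl); apply: l'S; rewrite index_mem.
exists (l ++ l'); split.
  by move=> x /=; rewrite mem_cat => /orP[/lS //|/l'S []].
move=> z Sz; have [y ly hy] := hl z Sz.
have Szy : S' (z - y).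
  split; last by move=> i iN; rewrite linearB hy // subrr.
  by apply: submodB => //; apply: (lspan_min hS lS ly).
have [|y' ly' hy'] := @lspan_map_ex _ _ (f N) l' (f N (z - y)).
  by rewrite l'm; apply: Im; exists (z - y).
exists (y + y').
  apply: lspanD; [apply: lspan_mono ly | apply: lspan_mono ly'] => x /= xl;
    by rewrite mem_cat xl ?orbT.
have [_ y'0] := lspan_min hS' l'S ly'.
move=> i; rewrite ltnS leq_eqVlt => /orP[/eqP->|iN].
  by rewrite linearD hy' linearB addrC subrK.
by rewrite linearD (y'0 i iN) addr0 hy.
Qed.

(** Pull [U] back along a presentation by [n] generators: vectors supported below [n] are determined
    by their first [n] coordinates, so [noetherian_coords] generates the preimage itself. *)
Lemma noetherian_sub_fin_gen (M : lmodType R) (U : set M) : fin_gen M -> submodule U ->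
  exists l : seq M, [set` l] `<=` U /\ U `<=` lspan [set` l].
Proof.
move=> [d hd] hU; pose n := size d.
pose q := fs_lift (fun i : nat => d`_i).
pose c i := mk_linear (fun a v w => @fcoefP R nat R^o i a v w).
pose S := [set v : fs nat R^o | (forall i, (n <= i)%N -> fcoef v i = 0) /\ U (q v)].
have hS : submodule S.
  split=> [|a v w [v0 Uv] [w0 Uw]].
    by split=> //; rewrite linear0; apply: submod0.
  split=> [i ni|]; first by rewrite fcoefP v0 // w0 // scaler0 addr0.
  by rewrite linearP; apply: submodZD.
have [l [lS hl]] := noetherian_coords c n hS.
exists (map q l); split=> [_ /= /mapP[v vl ->]|x Ux]; first by have [] := lS v vl.
have [a xE] := lspan_seqP (hd x).
pose v i : R^o := if (i < n)%N then a i else 0.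
have fv : finite_set [set i | v i <> 0].
  apply: (sub_finite_set _ (finite_II n)) => i /=; rewrite /v; by case: ifP.
have qv : q (mk_fs fv) = x.
  rewrite xE /q (@fs_liftE _ _ _ _ _ (iota 0 n)) ?iota_uniq //; last first.
    by move=> i; rewrite fcoef_mk /v mem_iota /=; case: ifP.
  rewrite -{1}[n]subn0 -/(index_iota 0 n) big_mkord; apply: eq_bigr => i _.
  by rewrite fcoef_mk /v ltn_ord.
have Sv : S (mk_fs fv).
  by split=> [i ni|]; rewrite ?qv // fcoef_mk /v ltnNge ni.
have [w lw vw] := hl _ Sv.
suff <- : q w = x.
  by apply: (lspan_image lw) => y /= yl; apply: sub_lspan => /=; apply: map_f.
rewrite -qv; congr (q _); apply: fs_ext => i.
have [ni|/vw/esym//] := leqP n i.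
by have [-> // _] := lspan_min hS lS lw; rewrite fcoef_mk /v ltnNge ni.
Qed.

(** The determinant trick: as [I] is generated by products from [I], its generators satisfy
    [g = A g] with entries of [A] in [I]. Then [e = 1 - det (1 - A)] lies in [I] and acts as the
    identity on [I], so it is idempotent and connectedness decides. *)
Lemma idempotent_ideal (I : set R^o) : connected_ring R -> submodule I ->
  (forall x, I x -> lspan [set r : R^o | exists a b : R, [/\ I a, I b & r = a * b]] x) ->
  (forall x, I x -> x = 0) \/ I 1.
Proof.
move=> cR hI II; have [l [lI Il]] := noetherian_ideal hI; pose n := size l.
have ex (i : 'I_n) : exists c : 'I_n -> R,
    (forall j, I (c j)) /\ l`_i = \sum_(j < n) c j * l`_j :> R.
  have Ili : I l`_i by apply: lI; apply: mem_nth.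
  apply: (II _ Ili [set x : R^o | exists c : 'I_n -> R,
    (forall j, I (c j)) /\ x = \sum_(j < n) c j * l`_j :> R]).
    split.
      exists (fun=> 0); split=> [j|]; first exact: (submod0 hI).
      by rewrite big1 // => j _; rewrite mul0r.
    move=> a _ _ [c [Ic ->]] [d [Id ->]]; exists (fun j => a * c j + d j); split.
      by move=> j; apply: (submodZD hI a).
    rewrite scaler_sumr -big_split /=; apply: eq_bigr => j _.
    by rewrite mulrDl -mulrA.
  move=> _ [a [b [Ia Ib ->]]]; have [c bE] := lspan_seqP (Il b Ib).
  exists (fun j => a * c j); split=> [j|]; first by rewrite mulrC; apply: (idealM hI).
  by rewrite bE mulr_sumr; apply: eq_bigr => j _; rewrite -mulrA.
have {ex} [c /all_and2[Ic lE]] := choice ex.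
pose A : 'M[R]_n := \matrix_(i, j) c i j; pose g : 'cV[R]_n := \col_i l`_i.
have Ag : (1%:M - A) *m g = 0.
  rewrite mulmxBl mul1mx; apply/matrixP => i j; rewrite !mxE lE.
  by apply/eqP; rewrite subr_eq0; apply/eqP; apply: eq_bigr => k _; rewrite !mxE.
pose e : R := 1 - \det (1%:M - A).
have Ie : I e.
  have := @det_cong R I n 1%:M (1%:M - A) hI; rewrite det1; apply=> i j.
  by rewrite !mxE subKr; apply: Ic.
have eg i : (i < n)%N -> e * l`_i = l`_i.
  move=> ilt; rewrite mulrBl mul1r.
  have : (\det (1%:M - A))%:M *m g = 0 by rewrite -mul_adj_mx -mulmxA Ag mulmx0.
  rewrite mul_scalar_mx => /matrixP /(_ (Ordinal ilt) 0); rewrite !mxE /= => ->.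
  by rewrite subr0.
have eI x : I x -> e * x = x.
  move=> /Il; apply: (@lspan_min R R^o [set` l] [set x : R^o | e * x = x :> R]).
    split=> [|a y z /= ey ez]; first exact: mulr0.
    by rewrite mulrDr ez [e * _]mulrCA ey.
  by move=> y /= yl; rewrite -(nth_index 0 yl); apply: eg; rewrite index_mem.
have [e0|e1] := cR e (eI e Ie); last by right; rewrite -e1.
by left=> x /eI; rewrite e0 mul0r.
Qed.

End Noetherian.

(** * Countably generated projective modules *)

Section BassCountable.
Variables (R : comNzRingType) (M : lmodType R).
Hypotheses (hR : noetherian R) (cR : connected_ring R).
Variables (s : {linear M -> fs nat R^o}) (q : {linear fs nat R^o -> M}).
Hypothesis sq : cancel s q.

Let f (i : nat) : {linear M -> R^o} := mk_linear (fun a x y =>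
  etrans (congr1 (fun v => fcoef v i) (linearP s a x y)) (@fcoefP R nat R^o i a (s x) (s y))).
Let p (i : nat) : M := q (single R i).

Lemma fs_nat_bound (A : lmodType R) (v : fs nat A) :
  exists N, forall i, (N <= i)%N -> fcoef v i = 0.
Proof.
exists (\max_(i <- fsupp v) i.+1)%N => i; apply: contraTeq => vi.
rewrite -ltnNge; have : i \in fsupp v by rewrite mem_fsupp.
by move=> iv; rewrite (big_rem i iv) /= leq_max leqnn.
Qed.

Let f_bound x : exists N, forall i, (N <= i)%N -> f i x = 0.
Proof. by have [N hN] := fs_nat_bound (s x); exists N. Qed.

Let expand x N : (forall i, (N <= i)%N -> f i x = 0) ->
  x = \sum_(k < N) (f k x : R) *: p k.
Proof.
move=> hN; rewrite -{1}[x]sq -[s x]fs_lift_single_id.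
rewrite (@fs_liftE _ _ _ _ _ (iota 0 N)) ?iota_uniq // => [|i xi]; last first.
  by rewrite mem_iota /= add0n ltnNge; apply/negP => /hN.
rewrite linear_sum -{1}[N]subn0 -/(index_iota 0 N) big_mkord.
by apply: eq_bigr => i _; rewrite linearZ.
Qed.

Let f_inj x : (forall i, f i x = 0) -> x = 0.
Proof. by move=> x0; rewrite (@expand x 0) // big_ord0. Qed.

Let fmat n (phi : 'I_n -> nat) (x : 'I_n -> M) : 'M[R]_n :=
  \matrix_(a, b) f (phi a) (x b).

(** This is the trace ideal of the [n]-th exterior power of [M], written with minors. *)
Let tau n : set R^o :=
  lspan [set r : R^o | exists (phi : 'I_n -> nat) x, r = \det (fmat phi x)].

Let tau_mem n (phi : 'I_n -> nat) x : tau n (\det (fmat phi x)).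
Proof. by apply: sub_lspan; exists phi, x. Qed.

Let tau_submod n : submodule (tau n). Proof. exact: lspan_submodule. Qed.

(** Expanding each [x b] over the [p k] factors [fmat phi x] through the matrices of the [f (p k)]
    and of the [f k (x b)]; by Cauchy-Binet its determinant is a sum of products of two
    [n]-minors. *)
Let tau_idem n r : tau n r ->
  lspan [set r : R^o | exists a b : R, [/\ tau n a, tau n b & r = a * b]] r.
Proof.
apply: lspan_min r => [|_ [phi [x ->]]]; first exact: lspan_submodule.
have [N hN] : exists N, forall b i, (N <= i)%N -> f i (x b) = 0.
  have [Nb hb] := choice (fun b => f_bound (x b)).
  exists (\max_b Nb b)%N => b i Ni; apply: hb; apply: leq_trans Ni.
  exact: leq_bigmax.
have -> : fmat phi x =
    (\matrix_(a < n, k < N) f (phi a) (p k)) *m (\matrix_(k < N, b < n) f k (x b)).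
  apply/matrixP => a b; rewrite !mxE {1}(expand (hN b)) linear_sum.
  by apply: eq_bigr => k _; rewrite !mxE linearZ [RHS]mulrC.
apply: det_mul_in => [|K _]; first exact: lspan_submodule.
apply: sub_lspan; do 2!eexists; split; last by [].
  have -> : colsub K (\matrix_(a < n, k < N) f (phi a) (p k)) = fmat phi (fun b => p (K b)).
    by apply/matrixP => a b; rewrite !mxE.
  exact: tau_mem.
have -> : rowsub K (\matrix_(k < N, b < n) f k (x b)) = fmat (fun a => K a : nat) x.
  by apply/matrixP => a b; rewrite !mxE.
exact: tau_mem.
Qed.

(* If all (n+1)-minors vanish, expanding the one bordering [fmat phi x] along its
   extra row exhibits [\det (fmat phi x) *: y] as a combination of the [x b]. *)
Let minor_scale n (phi : 'I_n -> nat) (x : 'I_n -> M) y :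
  (forall r, tau n.+1 r -> r = 0) ->
  lspan (range x) (\det (fmat phi x) *: y).
Proof.
move=> t0; pose z (j : 'I_n.+1) := if unlift ord0 j is Some b then x b else y.
pose ph h (j : 'I_n.+1) := if unlift ord0 j is Some a then phi a else h.
pose c j := cofactor (fmat (ph 0%N) z) ord0 j.
have cE h j : cofactor (fmat (ph h) z) ord0 j = c j.
  rewrite /c /cofactor; congr (_ * \det _); apply/matrixP => a b; rewrite !mxE.
  by rewrite /ph !liftK.
have sum0 : \sum_j c j *: z j = 0.
  apply: f_inj => h; rewrite linear_sum; apply: etrans (t0 _ (tau_mem (ph h) z)).
  rewrite (expand_det_row _ ord0); apply: eq_bigr => j _.
  by rewrite cE mxE /ph unlift_none linearZ [LHS]mulrC.
have c0 : c ord0 = \det (fmat phi x).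
  rewrite /c /cofactor addn0 expr0 mul1r; congr (\det _); apply/matrixP => a b.
  by rewrite !mxE /ph /z !liftK.
have <- : - (\sum_(j < n) c (lift ord0 j) *: x j) = \det (fmat phi x) *: y.
  have := sum0; rewrite big_ord_recl {1}/z unlift_none c0 => /eqP.
  rewrite addr_eq0 => /eqP ->; congr (- _); apply: eq_bigr => j _.
  by rewrite /z liftK.
rewrite -sumrN; apply: lspan_sum => j _; rewrite -scalerN -scaleN1r scalerA.
by apply: lspanZ; apply: sub_lspan; exists j.
Qed.

(** The scalars [r] for which [r M] lies in a finitely generated submodule form an ideal. It
    contains every [n]-minor by [minor_scale], hence 1. *)
Let tau_fg n : tau n 1 -> (forall r, tau n.+1 r -> r = 0) -> fin_gen M.
Proof.
move=> t1 t0.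
pose J := [set r : R^o | exists l : seq M, forall y, lspan [set` l] ((r : R) *: y)].
have hJ : submodule J.
  split=> [|a r r' [l hl] [l' hl']].
    by exists [::] => y; rewrite scale0r; apply: lspan0.
  exists (l ++ l') => y; rewrite scalerDl -scalerA; apply: lspanZD.
    by apply: lspan_mono (hl y) => x /= xl; rewrite mem_cat xl.
  by apply: lspan_mono (hl' y) => x /= xl; rewrite mem_cat xl orbT.
have [|l hl] := lspan_min hJ _ t1.
  move=> _ [phi [x ->]]; exists [seq x b | b <- enum 'I_n] => y.
  apply: (@lspan_mono R M (range x)); last exact: minor_scale.
  by move=> _ [b _ <-] /=; apply: map_f; rewrite mem_enum.
by exists l => x; rewrite -[x]scale1r.
Qed.

Hypothesis nfg : ~ fin_gen M.

Let tau_full n : tau n 1.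
Proof.
elim: n => [|n IH].
  have := tau_mem (fun i : 'I_0 => 0%N) (fun=> 0); congr (tau _ _).
  exact: det_mx00.
have [t0|//] := idempotent_ideal hR cR (tau_submod n.+1) (@tau_idem n.+1).
by case: nfg; apply: tau_fg IH t0.
Qed.

(** In other words [M] is not [I M] plus the span of [l]. Otherwise any [n.+1] elements, with
    [n = size l], would be congruent modulo [I] to combinations of [n] elements, whose [n.+1]-minors
    vanish; so [tau n.+1], the whole ring, would lie in [I]. *)
Lemma uniformly_big (I : set R^o) (l : seq M) : submodule I -> ~ I 1 ->
  exists x, forall y, lspan [set` l] y -> exists i, ~ I (f i (x - y)).
Proof.
move=> hI nI; apply: contrapT => /forallNP no; apply: nI; pose n := size l.
have {no} h x : exists y, lspan [set` l] y /\ forall i, I (f i (x - y)).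
  have /existsNP[y /not_implyP[ly /forallNP hy]] := no x.
  by exists y; split=> // i; apply: contrapT.
apply: (lspan_min hI _ (@tau_full n.+1)) => _ [phi [x ->]].
have [y /all_and2[ly hy]] := choice (fun b => h (x b)).
have [c hc] := choice (fun b => lspan_seqP (ly b)).
have d0 : \det (fmat phi y) = 0.
  have -> : fmat phi y =
     (\matrix_(a < n.+1, k < n) f (phi a) l`_k) *m (\matrix_(k < n, b < n.+1) c b k).
    apply/matrixP => a b; rewrite !mxE hc linear_sum; apply: eq_bigr => k _.
    by rewrite !mxE linearZ [RHS]mulrC.
  exact: det_mul_thin.
rewrite -[\det _]subr0 -d0; apply: det_cong => // a b.
by rewrite !mxE -linearB; apply: hy.
Qed.

Let content N x : set R^o := lspan [set r : R^o | exists2 i, (N <= i)%N & r = f i x].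

(* For [x] of maximal content [I], elements [y] of the kernel of the coordinates
   met by [x] satisfy [content (x + y) = I + content y]; were [I] proper, some
   such [y] would have content outside [I], the kernel being cofinite. *)
Lemma unimodular N : exists x, content N x 1.
Proof.
have [x xmax] := noetherian_max hR (0 : M) (fun x => lspan_submodule _ : submodule (content N x)).
exists x; apply: contrapT => nI.
have [N' NN' hN'] : exists2 N', (N <= N')%N & forall i, (N' <= i)%N -> f i x = 0.
  have [K hK] := f_bound x; exists (maxn N K); first exact: leq_maxl.
  by move=> i Ki; apply: hK; apply: leq_trans Ki; apply: leq_maxr.
have [l [_ hl]] := noetherian_coords hR f N' (lspan_submodule (setT : set M)).
have [z hz] := uniformly_big l (lspan_submodule _) nI.
have [w lw zw] := hl z (@sub_lspan _ _ setT z I).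
have [i yi] := hz w lw; pose y := z - w.
have y0 j : (j < N')%N -> f j y = 0 by move=> /zw jz; rewrite linearB jz subrr.
have sub : content N x `<=` content N (x + y).
  apply: lspan_min => [|_ [j Nj ->]]; first exact: lspan_submodule.
  have [jN'|N'j] := ltnP j N'; last by rewrite hN' //; apply: lspan0.
  by apply: sub_lspan; exists j; rewrite // linearD y0 // addr0.
have iN' : (N' <= i)%N.
  by rewrite leqNgt; apply/negP => /y0 iy; apply: yi; rewrite iy; apply: lspan0.
apply: yi; apply: (xmax (x + y) sub); apply: sub_lspan; exists i.
  exact: leq_trans iN'.
by rewrite (linearD (f i) x y) hN' // add0r.
Qed.

(** Shaped for iteration: the functional ignores the coordinates below [N], and the returned bound,
    past which the element has no coordinates, is the next [N]. Forcing it above [N] sends the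
    bounds to infinity. *)
Let unimodular_functional N : exists xgN : M * {linear M -> R^o} * nat,
  [/\ (N < xgN.2)%N, xgN.1.2 xgN.1.1 = 1,
      forall z, (forall i, (N <= i)%N -> f i z = 0) -> xgN.1.2 z = 0
    & forall i, (xgN.2 <= i)%N -> f i xgN.1.1 = 0].
Proof.
have [x hx] := unimodular N; have [K hK] := f_bound x.
have [|_ [i Ni ->]|g [gx g0]] := hx [set r : R^o | exists g : {linear M -> R^o},
    g x = r /\ forall z, (forall i, (N <= i)%N -> f i z = 0) -> g z = 0].
- split=> [|a _ _ [g [<- g0]] [h [<- h0]]]; first by exists \0.
  exists (a \*: g \+ h : {linear M -> R^o}); split=> // z hz /=.
  by rewrite g0 // h0 // scaler0 addr0.
- by exists (f i); split=> // z; apply.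
exists (x, g, maxn N.+1 K); split=> //=; first exact: leq_maxl.
by move=> i Ki; apply: hK; apply: leq_trans Ki; apply: leq_maxr.
Qed.

(** The matrix of the [g n (x m)] is triangular with unit diagonal: [x m] lives below the
    coordinates that [g n] reads when [m < n]. So unit vectors are reached by strong induction.
    Since the bounds grow, each [z] is seen by finitely many [g n], and [G] lands in the direct
    sum. *)
Let fs_nat_quotient : exists G : {linear M -> fs nat R^o}, surjective G.
Proof.
have [st hst] := choice unimodular_functional.
pose N := fix N n := if n is n'.+1 then (st (N n')).2 else 0%N.
pose x n := (st (N n)).1.1; pose g n := (st (N n)).1.2.
have NS n : (N n < N n.+1)%N by have [] := hst (N n).
have Nmono m n : (m <= n)%N -> (N m <= N n)%N.
  by move=> /subnK <-; elim: (n - m)%N => // k IH; apply: leq_trans IH (ltnW (NS _)).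
have Nn n : (n <= N n)%N by elim: n => // n IH; apply: leq_ltn_trans IH (NS n).
have gx n : g n (x n) = 1 by have [] := hst (N n).
have g0 n z : (forall i, (N n <= i)%N -> f i z = 0) -> g n z = 0.
  by have [_ _ h _] := hst (N n); apply: h.
have gx0 n m : (m < n)%N -> g n (x m) = 0.
  move=> mn; apply: g0 => i Ni; have [_ _ _ h] := hst (N m); apply: h.
  exact: leq_trans (Nmono _ _ mn) Ni.
have fing z : finite_set [set n | g n z <> 0].
  have [K hK] := f_bound z; apply: (sub_finite_set _ (finite_II K)) => n /= gn.
  rewrite ltnNge; apply/negP => Kn; apply: gn; apply: g0 => i Ni; apply: hK.
  exact: leq_trans Kn (leq_trans (Nn n) Ni).
have Glin : linear (fun z => mk_fs (fing z)).
  by move=> a y z; apply: fs_ext => n; rewrite fcoefP !fcoef_mk linearP.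
pose G := mk_linear Glin; exists G.
suff hG n : range G (single R n).
  move=> v; suff [z _ <-] : range G v by exists z.
  rewrite -[v]fs_lift_single_id fs_lift_supp; apply: submod_sum => [|i _].
    exact: submod_range.
  by apply: submodZ => //; apply: submod_range.
have [m] := ubnP n; elim: m n => // m IH n nm.
have -> : single R n = G (x n) - \sum_(j < n) (g j (x n) : R) *: single R (j : nat).
  apply: fs_ext => k; rewrite fcoefB fcoef_sum singleE [fcoef (G _) k]fcoef_mk.
  under eq_bigr do rewrite fcoefZ singleE.
  have [kn|nk|->] := ltngtP k n.
  - rewrite (bigD1 (Ordinal kn)) //= eqxx [_ *: _]mulr1 big1 ?addr0 ?subrr //.
    by move=> j; rewrite -val_eqE eq_sym /= => /negbTE ->; rewrite scaler0.
  - rewrite gx0 // big1 ?subr0 // => j _; rewrite gtn_eqF ?scaler0 //.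
    exact: ltn_trans (ltn_ord j) nk.
  - by rewrite gx big1 ?subr0 // => j _; rewrite gtn_eqF ?scaler0.
apply: submodB; [exact: submod_range | by exists (x n) |].
apply: submod_sum => [|j _]; first exact: submod_range.
apply: submodZ; [exact: submod_range | apply: IH].
exact: leq_trans (ltn_ord j) nm.
Qed.

Lemma bass_split : isomorphic M (fs nat R^o).
Proof.
have [G sG] := fs_nat_quotient.
have [X GX] := projective_section (@projective_fs R nat) sG.
have [c [d [cd dc]]] := isoP (fs_nat_self R).
apply: iso_trans (iso_sym (fs_nat_self R)).
apply: (@swindle R M s q sq (c \o G : {linear M -> _}) (X \o d : {linear _ -> M})).
by move=> w /=; rewrite GX dc.
Qed.

End BassCountable.

Theorem bass_countable (R : comNzRingType) (M : lmodType R) :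
  noetherian R -> connected_ring R -> projective M -> cnt_gen M -> ~ fin_gen M ->
  isomorphic M (fs nat R^o).
Proof.
move=> hR cR pM /cnt_gen_lift[q sq] nfg; have [s qs] := projective_section pM sq.
exact: bass_split hR cR _ _ qs nfg.
Qed.

(** * Projective modules of arbitrary size *)

Section Kaplansky.
Variables (R : comNzRingType) (M : lmodType R).
Hypotheses (hR : noetherian R) (cR : connected_ring R) (pM : projective M).

(** All elements of [M] are taken as generators, so a subset of [M] is at once a set of coordinates
    and a set to span with. *)
Let q : {linear fs M R^o -> M} := fs_lift (fun x : M => x).
Variable s : {linear M -> fs M R^o}.
Hypothesis sq : cancel s q.

Let q_single x : q (single R x) = x. Proof. exact: fs_lift_single. Qed.

Section Restriction.
Variable J : set M.

Let restr_fun (v : fs M R^o) i : R^o := if `[< J i >] then fcoef v i else 0.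

Let restr_finite v : finite_set [set i | restr_fun v i <> 0].
Proof.
by apply: sub_finite_set (fcoef_finite v) => i /=; rewrite /restr_fun; case: ifP.
Qed.

Let restr_linear : linear (fun v => mk_fs (restr_finite v)).
Proof.
move=> a v w; apply: fs_ext => i; rewrite fcoefP !fcoef_mk /restr_fun.
by case: ifP => _; rewrite ?fcoefP // scaler0 addr0.
Qed.

Definition restr : {linear fs M R^o -> fs M R^o} := mk_linear restr_linear.

Lemma restrE v i : fcoef (restr v) i = if `[< J i >] then fcoef v i else 0.
Proof. by []. Qed.

Lemma restr_id v : (forall i, fcoef v i <> 0 -> J i) -> restr v = v.
Proof.
move=> vJ; apply: fs_ext => i; rewrite restrE; case: ifP => // /asboolP nJ.
by apply: esym; apply: contrapT => /vJ.
Qed.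

Lemma restr_single i : restr (single R i) = if `[< J i >] then single R i else 0.
Proof.
apply: fs_ext => j; rewrite restrE singleE; case: (j =P i) => [->|ji].
  by case: ifP => //; rewrite singleE eqxx.
by rewrite mulr0n if_same; case: ifP => // _; rewrite singleE; case: eqP.
Qed.

Lemma restr_supp v i : fcoef (restr v) i <> 0 -> J i.
Proof. by rewrite restrE; case: asboolP. Qed.

Definition pi : {linear M -> M} := (q \o (restr \o s)).

Lemma pi_span x : lspan J (pi x).
Proof. by apply: fs_lift_span => i /restr_supp Ji; apply: sub_lspan. Qed.

(** The condition under which [lspan J] is a summand: [s] sends it to vectors supported on [J], so
    [pi J] fixes it. *)
Definition closed := forall i, J i -> forall j, fcoef (s i) j <> 0 -> J j.

Hypothesis cJ : closed.

Lemma pi_id x : lspan J x -> pi x = x.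
Proof.
move=> h; apply: (h _ (im_submodule pi)) => i Ji.
rewrite /mkset -[pi i]/(q (restr (s i))) restr_id ?sq // => k; exact: cJ.
Qed.

Lemma pi_idem x : pi (pi x) = pi x.
Proof. by apply: pi_id; apply: pi_span. Qed.

End Restriction.

(** Supports are finite, so adding them in countably many rounds keeps the set countable. *)
Lemma closed_closure (C : set M) : countable C ->
  exists C', [/\ countable C', closed C' & C `<=` C'].
Proof.
move=> cC; pose next (X : set M) := \bigcup_(i in X) [set j | fcoef (s i) j <> 0].
have cn X : countable X -> countable (next X).
  move=> cX; apply: bigcup_countable => // i _; apply: finite_set_countable.
  exact: fcoef_finite.
exists (\bigcup_n iter n next C); split.
- by apply: bigcup_countable => // n _; elim: n => // n IH; apply: cn.
- by move=> i [n _ Ci] j sij; exists n.+1 => //; exists i.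
- by move=> i Ci; exists 0%N.
Qed.

Section Layer.
Variables J J' : set M.
Hypotheses (cJ : closed J) (cJ' : closed J') (JJ' : J `<=` J').

(** The projection onto the part of [lspan J'] killed by [pi J], a complement of [lspan J] in
    [lspan J']. *)
Definition layer : {linear M -> M} := (pi J' \- (pi J \o pi J')).

Lemma layerE x : layer x = pi J' x - pi J (pi J' x). Proof. by []. Qed.

Lemma pi_layer x : pi J (layer x) = 0.
Proof. by rewrite layerE linearB pi_idem // subrr. Qed.

Lemma layer_span x : lspan J' (layer x).
Proof.
apply: lspanB; first exact: pi_span.
by apply: (lspan_mono JJ'); apply: pi_span.
Qed.

Lemma layer_idem x : layer (layer x) = layer x.
Proof. by rewrite {1}layerE pi_id ?pi_layer ?subr0 //; apply: layer_span. Qed.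

Lemma layer_split x : lspan J' x -> x = pi J x + layer x.
Proof. by move=> /(pi_id cJ') xE; rewrite layerE xE addrC subrK. Qed.

End Layer.

(** Choose each [x n] outside the span of [J] and the earlier ones, and close the sequence off to a
    countable [C]. The layer is generated by the image of [C], as [J] maps to 0 in it. *)
Lemma closed_extension J : closed J ->
  ~ (exists l : seq M, forall x, lspan (J `|` [set` l]) x) ->
  exists J' (cJ : closed J) (cJ' : closed J') (JJ' : J `<=` J'),
    cnt_gen (imM (layer J J')) /\ ~ fin_gen (imM (layer J J')).
Proof.
move=> cJ nJ.
have /choice[nx hnx] : forall l : seq M, exists x, ~ lspan (J `|` [set` l]) x.
  move=> l; apply: contrapT => /forallNP h; apply: nJ; exists l => x.
  exact: contrapT (h x).
pose L := fix L n := if n is n'.+1 then rcons (L n') (nx (L n')) else [::].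
pose x n := nx (L n).
have [C [cC clC xC]] := closed_closure (card_image_le x [set: nat]).
have cJ' : closed (J `|` C).
  by move=> i [Ji|Ci] j sij; [left; apply: cJ Ji _ sij | right; apply: clC Ci _ sij].
have JJ' : J `<=` J `|` C by exact: subsetUl.
exists (J `|` C), cJ, cJ', JJ'; set e := layer J (J `|` C).
pose P := im_proj (layer_idem cJ cJ' JJ').
split.
  exists (P @` C) => [|y]; first by apply: sub_countable cC; apply: card_image_le.
  rewrite -(im_inclK (layer_idem cJ cJ' JJ') y).
  have : lspan (J `|` C) (val y) by rewrite -(subMP y); apply: layer_span.
  move=> /(lspan_image (f := P)); apply => i [Ji|Ci]; last by apply: sub_lspan; exists i.
  suff -> : P i = 0 by exact: lspan0.
  apply: val_inj; rewrite -[LHS]/(layer J (J `|` C) i) layerE (pi_id cJ') ?(pi_id cJ) ?subrr //.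
    exact: sub_lspan.
  by apply: sub_lspan; left.
(* Were the layer finitely generated, the ascending spans of the images of [x 0], ..., [x n.-1]
   would stabilize over the Noetherian ring; some [x m] would then depend on [J] and its
   predecessors, against its choice. *)
move=> fgD; pose S n : set (imM e) := lspan [set P (x k) | k in [set k | (k < n)%N]].
have hS n : submodule (S n) by exact: lspan_submodule.
have Sm n : S n `<=` S n.+1.
  by apply: lspan_mono => _ [k /= kn <-]; exists k => //=; apply: ltnW.
have [l [lU Ul]] := noetherian_sub_fin_gen hR fgD (chain_union hS Sm).
have [m lm] := chain_finite Sm lU.
have xL k n : (k < n)%N -> x k \in L n.
  elim: n => // n IH; rewrite ltnS leq_eqVlt => /orP[/eqP->|/IH].
    by rewrite /= mem_rcons inE eqxx.
  by rewrite /= mem_rcons inE orbC => ->.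
have xJ' n : lspan (J `|` C) (x n) by apply: sub_lspan; right; apply: xC; exists n.
apply: (hnx (L m)); rewrite -/(x m) (layer_split J cJ' (xJ' m)).
have JL y : lspan J y -> lspan (J `|` [set` L m]) y by apply: lspan_mono; apply: subsetUl.
apply: lspanD; first by apply: JL; apply: pi_span.
have : S m (P (x m)).
  apply: (lspan_min (hS m) lm); apply: Ul; exists m.+1 => //.
  by apply: sub_lspan; exists m => //=.
move=> /(lspan_image (f := im_incl e)); apply => _ [k /= km <-].
rewrite -[lspan _ _]/(lspan _ (e (x k))).
have -> : e (x k) = x k - pi J (x k).
  by rewrite {2}(layer_split J cJ' (xJ' k)) addrC addKr.
apply: lspanB; first by apply: sub_lspan; right; apply: xL.
by apply: JL; apply: pi_span.
Qed.

Let indep (B : set M) := forall v : fs M R^o,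
  (forall i, fcoef v i <> 0 -> B i) -> q v = 0 -> v = 0.

(** The order is on bases alone, the closed set being merely asserted to exist. Members of a chain
    thus need no compatible choice of [J]: [good_chain] takes the union of all closed sets that fit
    some member. *)
Let good (B : set M) := indep B /\
  exists J, closed J /\ forall x, lspan B x <-> lspan J x.

Let good_chain (F : set (set M)) : F `<=` good -> total_on F subset ->
  good (\bigcup_(X in F) X).
Proof.
move=> Fg Ft; split.
  move=> v vF qv.
  have : fsupp v = [::] \/ exists2 B, F B & [set` fsupp v] `<=` B.
    have : [set` fsupp v] `<=` \bigcup_(X in F) X.
      by move=> i /=; rewrite mem_fsupp => /eqP /vF.
    elim: (fsupp v) => [|i l IH] h; first by left.
    right; have [C FC Ci] : (\bigcup_(X in F) X) i by apply: h => /=; rewrite inE eqxx.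
    have [|->|[B FB lB]] := IH.
    - by move=> j /= jl; apply: h => /=; rewrite inE jl orbT.
    - by exists C => // j /=; rewrite inE => /eqP->.
    - have [BC|CB] := Ft _ _ FB FC.
        by exists C => // j /=; rewrite inE => /orP[/eqP->|/lB/BC].
      by exists B => // j /=; rewrite inE => /orP[/eqP->|/lB//]; apply: CB.
  case=> [v0|[B FB vB]].
    by apply: fs_ext => i; apply/eqP/negbNE; rewrite -mem_fsupp v0.
  have [iB _] := Fg _ FB; apply: iB => // i vi; apply: vB.
  by rewrite /= mem_fsupp; apply/eqP.
pose isJ B J := closed J /\ forall x, lspan B x <-> lspan J x.
exists [set j | exists B J, [/\ F B, isJ B J & J j]]; split.
  by move=> i [B [J [FB [cJ BJ] Ji]]] j sij; exists B, J; split=> //; apply: cJ Ji _ sij.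
move=> x; split; apply: (lspan_min (lspan_submodule _)) => {}x.
  move=> [B FB Bx]; have [_ [J [cJ BJ]]] := Fg _ FB.
  have : lspan J x by apply/BJ; apply: sub_lspan.
  by apply: lspan_mono => j Jj; exists B, J.
move=> [B [J [FB [cJ BJ] Jx]]]; have : lspan B x by apply/BJ; apply: sub_lspan.
by apply: lspan_mono => j Bj; exists B.
Qed.

(** Adjoin to [B] the basis [b] of the layer. A relation splits into a relation on [B] and one on
    [b], because [pi J] fixes [lspan B] and kills each [b n]. *)
Let good_extend B J J' (cJ : closed J) (cJ' : closed J') (JJ' : J `<=` J') :
  indep B -> (forall x, lspan B x <-> lspan J x) ->
  isomorphic (imM (layer J J')) (fs nat R^o) ->
  exists2 B', good B' & B `<` B'.
Proof.
move=> iB BJ /iso_sym/isoP[th [ht [thK htK]]].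
pose V := im_incl (layer J J'); pose b n := V (th (single R n)).
have bi : injective b.
  move=> m n /val_inj/(can_inj thK)/(congr1 (fun v => fcoef v m)).
  rewrite !singleE eqxx; case: eqP => // _ /eqP; by rewrite oner_eq0.
have bL n : layer J J' (b n) = b n by exact: (subMP (th (single R n))).
have pib n : pi J (b n) = 0 by rewrite -bL pi_layer.
have thE w : lspan (range b) (V (th w)).
  rewrite -[w]fs_lift_single_id fs_lift_supp !linear_sum; apply: lspan_sum => n _.
  by rewrite !linearZ; apply: lspanZ; apply: sub_lspan; exists n.
have Bb n : ~ B (b n).
  move=> Bn; have /(pi_id cJ) : lspan J (b n) by apply/BJ; apply: sub_lspan.
  rewrite pib => b0; have /(can_inj thK)/(congr1 (fun v => fcoef v n)) : th (single R n) = th 0.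
    by apply: val_inj; rewrite linear0; apply: esym.
  by rewrite singleE eqxx => /eqP; rewrite oner_eq0.
exists (B `|` range b); last first.
  split; first exact: subsetUl.
  by move=> /(_ (b 0%N)) h; apply: (Bb 0%N); apply: h; right; exists 0%N.
split; last first.
  exists J'; split=> // x; split; apply: (lspan_min (lspan_submodule _)) => {}x.
    move=> [Bx|[n _ <-]]; last by rewrite -bL; apply: layer_span.
    by apply: (lspan_mono JJ'); apply/BJ; apply: sub_lspan.
  move=> J'x; rewrite (layer_split J cJ' (sub_lspan J'x)).
  apply: lspanD.
    apply: (@lspan_mono _ _ B); first exact: subsetUl.
    by apply/BJ; apply: pi_span.
  apply: (@lspan_mono _ _ (range b)); first exact: subsetUr.
  by have := thE (ht (im_proj (layer_idem cJ cJ' JJ') x)); rewrite htK.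
move=> v vB qv.
have qB : lspan J (q (restr B v)).
  by apply/BJ; apply: fs_lift_span => i /restr_supp Bi; apply: sub_lspan.
have vBb i : fcoef (v - restr B v) i <> 0 -> range b i.
  rewrite fcoefB restrE; case: asboolP => Bi; rewrite ?subrr // subr0 => /vB.
  by case.
have q' : pi J (q (v - restr B v)) = 0.
  have : lspan (range b) (q (v - restr B v)).
    by apply: fs_lift_span => i /vBb; apply: sub_lspan.
  move=> h; apply: (h [set x | pi J x = 0]); first exact: ker_submodule.
  by move=> _ [n _ <-].
have rB0 : restr B v = 0.
  apply: iB => [i|]; first exact: restr_supp.
  rewrite -(pi_id cJ qB) -[restr B v](subKr v) linearB qv sub0r.
  by rewrite linearN q' oppr0.
rewrite rB0 subr0 in vBb.
(* Reading [w] along [b] and mapping it by [th] amounts to evaluating the part of [w] supported on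
   [range b]; injectivity of [th] then turns [q v = 0] into [v = 0]. *)
have comp w : V (th (fs_comp R^o bi w)) = q (restr (range b) w).
  apply: (@fs_lin_ext R M M (V \o (th \o fs_comp R^o bi) : {linear _ -> _})
    (q \o restr (range b) : {linear _ -> _})) => i.
  rewrite -[LHS]/(V (th (fs_comp R^o bi (single R i)))).
  rewrite -[RHS]/(q (restr (range b) (single R i))) restr_single; case: asboolP => [[n _ <-]|nb].
    by rewrite fs_comp_single q_single.
  rewrite linear0 -[RHS](linear0 (V \o th : {linear _ -> _})); congr (V (th _)).
  apply: fs_ext => n; rewrite fs_compE singleE; case: eqP => // bn.
  by case: nb; exists n.
have v0 n : fcoef v (b n) = 0.
  rewrite -(fs_compE bi) (_ : fs_comp _ _ _ = 0) //.
  apply: (can_inj thK); apply: val_inj.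
  by rewrite [LHS]comp restr_id // qv linear0.
by apply: fs_ext => i; apply: contrapT => vi; have [n _ bn] := vBb i vi; apply: vi; rewrite -bn v0.
Qed.

(** Over a maximal [B] with closed set [J], [M] is finitely generated modulo [lspan J]: otherwise
    [closed_extension] gives a layer that [bass_countable] makes free, and [B] could grow. [L] is
    the kernel of [pi J]. *)
Lemma free_plus_fin_gen : exists (I : choiceType) (L : lmodType R),
  [/\ isomorphic M (fs I R^o * L)%type, fin_gen L & projective L].
Proof.
have [B [[iB [J [cJ BJ]]] Bmax]] := Zorn_bigcup good_chain.
have [l hl] : exists l : seq M, forall x, lspan (J `|` [set` l]) x.
  apply: contrapT => /(closed_extension cJ)[J' [_ [cJ' [JJ' [cD nD]]]]].
  have pD := projective_im (layer_idem cJ cJ' JJ') pM.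
  have [B' gB' BB'] := good_extend cJ cJ' JJ' iB BJ (bass_countable hR cR pD cD nD).
  exact: Bmax BB' gB'.
have pp := pi_idem cJ.
exists {x : M | `[< B x >]}, (kerM (pi J)); split.
- apply: iso_trans (idem_split pp) (iso_prod _ (iso_refl _)); apply: iso_sym.
  pose j (x : {x : M | `[< B x >]}) : M := val x.
  have ji : injective j by exact: val_inj.
  pose g : {linear fs _ R^o -> imM (pi J)} := (im_proj pp \o fs_lift j).
  have gE v : val (g v) = fs_lift j v.
    apply: (pi_id cJ); apply/BJ; apply: fs_lift_span => i _.
    by apply: sub_lspan; apply/asboolP; apply: (valP i).
  apply: (bij_iso (f := g)) => [|y].
    apply: raddf_inj => v gv.
    have : fs_lift j v = 0 by rewrite -gE gv.
    pose w := fs_lift (fun x => single R (j x)) v.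
    have qw : q w = fs_lift j v.
      apply: (@fs_lin_ext R _ M (q \o fs_lift _ : {linear _ -> _}) (fs_lift j)) => x.
      by rewrite fs_lift_single -[LHS]/(q (fs_lift _ (single R x))) fs_lift_single.
    rewrite -qw => /iB w0; rewrite -(fs_comp_lift ji v) -/w w0 ?linear0 //.
    move=> i; rewrite /w fs_lift_supp fcoef_sum => h; apply: contrapT => nB; apply: h.
    apply: big1 => x _; rewrite fcoefZ singleE; case: eqP => [ix|_]; last exact: scaler0.
    by case: nB; rewrite ix; apply/asboolP; apply: (valP x).
  have : lspan B (val y) by apply/BJ; rewrite -(subMP y); apply: pi_span.
  move=> h; have [||v _ vy] := h (range (fs_lift j)); first exact: submod_range.
    by move=> x Bx; exists (single R (exist _ x (asboolT Bx))) => //; rewrite fs_lift_single.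
  by exists v; apply: val_inj; rewrite gE.
- exists [seq ker_proj pp x | x <- l] => y; rewrite -(ker_inclK pp y).
  apply: (lspan_image (hl (val y))) => i [Ji|/= il].
    suff -> : ker_proj pp i = 0 by exact: lspan0.
    by apply: val_inj; rewrite -[LHS]/(i - pi J i) pi_id ?subrr //; apply: sub_lspan.
  by apply: sub_lspan => /=; apply: map_f.
- exact: projective_ker.
Qed.

(** The first layer, over the empty set, is a summand of [M] itself. *)
Lemma countable_summand : ~ fin_gen M -> exists D K : lmodType R,
  [/\ isomorphic M (D * K)%type, cnt_gen D & ~ fin_gen D].
Proof.
move=> nM; have c0 : closed set0 by [].
have [|J' [cJ [cJ' [JJ' [cD nD]]]]] := closed_extension c0.
  by move=> [l hl]; apply: nM; exists l => x; have := hl x; rewrite set0U.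
exists (imM (layer set0 J')), (kerM (layer set0 J')); split=> //.
exact: (idem_split (layer_idem cJ cJ' JJ')).
Qed.

End Kaplansky.

Lemma cnt_gen_prod (R : comNzRingType) (M N : lmodType R) :
  cnt_gen M -> cnt_gen N -> cnt_gen (M * N)%type.
Proof.
have il : linear (fun x : M => (x, 0 : N)).
  by move=> a x y; rewrite -[RHS]/(_, _) /= scaler0 addr0.
have ir : linear (fun x : N => (0 : M, x)).
  by move=> a x y; rewrite -[RHS]/(_, _) /= scaler0 addr0.
move=> [X cX hX] [Y cY hY].
exists (mk_linear il @` X `|` mk_linear ir @` Y).
  rewrite -bigcup2E; apply: bigcup_countable => // -[|[|n]] _ /=.
  - by apply: sub_countable cX; apply: card_image_le.
  - by apply: sub_countable cY; apply: card_image_le.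
  - exact: countable0.
move=> [x y]; have -> : (x, y) = mk_linear il x + mk_linear ir y :> (M * N)%type.
  by rewrite /= -[RHS]/(_, _) addr0 add0r.
apply: lspanD.
  by apply: (lspan_image (hX x)) => z Xz; apply: sub_lspan; left; exists z.
by apply: (lspan_image (hY y)) => z Xz; apply: sub_lspan; right; exists z.
Qed.

Lemma projective_prodl (R : comNzRingType) (M N : lmodType R) :
  projective (M * N)%type -> projective M.
Proof.
have il : linear (fun x : M => (x, 0 : N)).
  by move=> a x y; rewrite -[RHS]/(_, _) /= scaler0 addr0.
exact: (@projective_retract R (M * N)%type M (mk_linear il) fst).
Qed.

Lemma inj_card_leT (T U : Type) (f : T -> U) :
  injective f -> [set: T] #<= [set: U].
Proof.
move=> fi; apply: (@card_le_trans _ _ _ (range f)); last exact: subset_card_le.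
by have /card_eqPle[] : range f #= [set: T] by apply: inj_card_eq; apply: in2W.
Qed.

(** [D] is split off before [free_plus_fin_gen] is applied to its complement [K], so that it can
    absorb the finitely generated [L]: Bass's theorem applies to [D * L]. *)
Theorem big_projective_free (R : comNzRingType) (M : lmodType R) :
  noetherian R -> connected_ring R -> projective M -> ~ fin_gen M ->
  exists I : choiceType, infinite_set [set: I] /\ isomorphic M (fs I R^o).
Proof.
move=> hR cR pM nM.
have section (N : lmodType R) : projective N ->
    exists t : {linear N -> fs N R^o}, cancel t (fs_lift (fun x : N => x)).
  move=> pN; apply: projective_section pN _ => x; exists (single R x).
  exact: fs_lift_single.
have [s sq] := section _ pM.
have [D [K [MDK cD nD]]] := countable_summand hR sq nM.
have pDK := iso_projective MDK pM.
have pK : projective K.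
  by apply: (@projective_prodl _ K D); apply: iso_projective pDK; apply: iso_prodC.
have [t tq] := section _ pK.
have [I [L [KIL fL pL]]] := free_plus_fin_gen hR cR pK tq.
have MDL : isomorphic M ((D * L) * fs I R^o)%type.
  apply: iso_trans MDK _; apply: iso_trans (iso_prodA D L _).
  exact: iso_prod (iso_refl D) (iso_trans KIL (iso_prodC _ _)).
have DLn : isomorphic (D * L)%type (fs nat R^o).
  apply: bass_countable => //.
  - exact: projective_prodl (iso_projective MDL pM).
  - exact: cnt_gen_prod cD (fin_gen_cg fL).
  - by move=> fDL; apply: nD; apply: (fin_gen_surj (f := fst)) fDL => x; exists (x, 0).
exists (nat + I)%type; split.
  by apply/infiniteP; apply: inj_card_leT (@inl_inj nat I).
apply: iso_trans MDL _; apply: iso_trans (iso_sym (fs_sum_prod R nat I)).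
exact: iso_prod DLn (iso_refl _).
Qed.

(** * Cardinality and slender rings *)

Section Cardinals.

Lemma card_le_fun (T U : Type) (A : set T) (B : set U) : A #<= B ->
  exists f : A -> U, injective f /\ forall x, B (f x).
Proof.
move=> /card_leP[f]; exists (fun x => set_val (f x)); split=> [x y /val_inj|x].
  by apply: inj; rewrite inE.
exact: set_valP.
Qed.

Lemma card_leT_inj (T U : Type) :
  [set: T] #<= [set: U] -> exists f : T -> U, injective f.
Proof.
move=> /card_le_fun[f [fi _]]; exists (fun x => f (SigSub (mem_setT x))).
by move=> x y /fi /(congr1 val).
Qed.

Lemma card_nat_le_inj (T : Type) (A : set T) : infinite_set A ->
  exists c : nat -> T, injective c /\ forall n, A (c n).
Proof.
move=> /infiniteP/card_le_fun[f [fi fA]].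
exists (fun n => f (SigSub (mem_setT n))); split=> // x y /fi /(congr1 val).
by [].
Qed.

(* Zorn's lemma applies to the graphs of injections from [A * nat] into [A], for
   [A] a subset of [I]; the maximal [A] is cofinite. *)
Lemma infinite_mul_nat (I : Type) : infinite_set [set: I] ->
  exists h : I * nat -> I, injective h.
Proof.
move=> Iinf.
(* The third clause makes the domain of the graph a full product [A * nat] and keeps its values
   inside [A]. *)
pose P (G : set ((I * nat) * I)) := [/\ forall x a b, G (x, a) -> G (x, b) -> a = b,
  forall x y a, G (x, a) -> G (y, a) -> x = y
  & forall i n a, G ((i, n), a) ->
      forall m, (exists c, G ((i, m), c)) /\ (exists c, G ((a, m), c))].
have [G [[Gf Gi Gc] Gmax]] : exists G, P G /\ forall G', G `<` G' -> ~ P G'.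
  apply: Zorn_bigcup => F FP Ft.
  have both x y : (\bigcup_(X in F) X) x -> (\bigcup_(X in F) X) y ->
      exists X, [/\ F X, X x & X y].
    move=> [X FX Xx] [Y FY Yy]; have [XY|YX] := Ft _ _ FX FY.
      by exists Y; split=> //; apply: XY.
    by exists X; split=> //; apply: YX.
  split=> [x a b ha hb|x y a ha hb|i n a [X FX Xa] m].
  - by have [X [FX]] := both _ _ ha hb; have [h _ _] := FP _ FX; apply: h.
  - by have [X [FX]] := both _ _ ha hb; have [_ h _] := FP _ FX; apply: h.
  - have [_ _ h] := FP _ FX; have [[c Xc] [d Xd]] := h _ _ _ Xa m.
    by split; [exists c | exists d]; exists X.
pose A := [set i | exists a, G ((i, 0%N), a)].
have GA i n a : G ((i, n), a) -> A i /\ A a.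
  by move=> /Gc /(_ 0%N) [? ?].
have fA : finite_set (~` A).
  (* An infinite complement contains a sequence [c]; coding pairs of naturals maps its product with
     [nat] injectively back into it, which enlarges [G]. *)
  apply: contrapT => /card_nat_le_inj[c [ci cA]].
  pose e (n m : nat) := c (pickle (n, m)).
  have ei n m n' m' : e n m = e n' m' -> (n, m) = (n', m').
    by move=> /ci /(pcan_inj pickleK).
  pose G' := G `|` [set x | exists n m, x = ((c n, m), e n m)].
  apply: (Gmax G').
    split; first exact: subsetUl.
    move=> /(_ ((c 0%N, 0%N), e 0%N 0%N)) h.
    by have [] := GA _ _ _ (h (or_intror (ex_intro _ 0%N (ex_intro _ 0%N erefl)))) => /cA.
  split.
  - move=> x a b [Ga|[n [m [xE aE]]]] [Gb|[n' [m' [xE' bE]]]].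
    + exact: Gf Ga Gb.
    + by rewrite xE' in Ga; have [/cA] := GA _ _ _ Ga.
    + by rewrite xE in Gb; have [/cA] := GA _ _ _ Gb.
    + by move: xE'; rewrite aE bE xE => -[/ci -> ->].
  - move=> [i k] [j l] a [Ga|[n [m [iE kE aE]]]] [Gb|[n' [m' [jE lE aE']]]].
    + exact: Gi Ga Gb.
    + by rewrite aE' in Ga; have [_ /cA] := GA _ _ _ Ga.
    + by rewrite aE in Gb; have [_ /cA] := GA _ _ _ Gb.
    + by move: aE'; rewrite aE iE kE jE lE => /ei[-> ->].
  - move=> i n a [Ga|[n' [m' [-> _ ->]]]] m.
      by have [[b Gb] [d Gd]] := Gc _ _ _ Ga m; split; [exists b | exists d]; left.
    split; first by exists (e n' m); right; exists n', m.
    by eexists; right; exists (pickle (n', m')), m.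
have [a0 Aa0] : A !=set0.
  apply/set0P/negP => /eqP A0; apply: Iinf.
  by rewrite -(setvU A) A0 setU0 -[X in ~` X]A0.
have /choice[h0 hh0] : forall x, exists a, A x.1 -> G (x, a).
  move=> [i n]; have [[b Gb]|nA] := pselect (A i); last by exists i.
  by have [[c Gc'] _] := Gc _ _ _ Gb n; exists c.
have h0A x : A x.1 -> A (h0 x).
  by case: x => i n /hh0 /GA[].
have h0i x y : A x.1 -> A y.1 -> h0 x = h0 y -> x = y.
  by move=> /hh0 Gx /hh0 Gy xy; rewrite xy in Gx; apply: Gi Gx Gy.
have /countable_injP[k ki] := finite_set_countable fA.
(* The finitely many points outside [A] are stored above [a0], from level 1 on: level 0 is occupied
   by [A]. *)
pose j0 i := if `[< A i >] then (i, 0%N) else (a0, (k i).+1).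
have j0A i : A (j0 i).1 by rewrite /j0; case: asboolP.
have j0i : injective j0.
  move=> x y; rewrite /j0; case: asboolP => Ax; case: asboolP => Ay //; first by case.
  by case=> /ki; apply; rewrite inE.
exists (fun x => h0 (h0 (j0 x.1), x.2)) => -[x m] [y n] /= xy.
have [xy' ->] : (h0 (j0 x), m) = (h0 (j0 y), n).
  by apply: h0i xy => /=; apply: h0A; apply: j0A.
by have /j0i -> : j0 x = j0 y by apply: h0i xy'; apply: j0A.
Qed.

(** Numbering each fibre embeds [K] in [I * nat]. *)
Lemma finite_fibers_inj (I K : Type) (r : K -> I) : infinite_set [set: I] ->
  (forall i, finite_set [set k | r k = i]) -> exists f : K -> I, injective f.
Proof.
move=> /infinite_mul_nat[h hi] fr.
have /choice[nu hnu] : forall i, exists f : K -> nat, {in [set k | r k = i] &, injective f}.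
  by move=> i; apply/countable_injP/finite_set_countable.
exists (fun k => h (r k, nu (r k) k)) => x y /hi[rxy]; rewrite -rxy => /hnu; apply; by rewrite inE.
Qed.

End Cardinals.

(** * The strong rank condition and maps between powers of the ring *)

Section StrongRank.
Variable R : comNzRingType.

(* The last column of [B] vanishes, so a monic polynomial killing [B] has zero
   constant term; as [B] is cancellable on the right, a factor ['X] can be removed. *)
Lemma strong_rank (n : nat) (A : 'M[R]_(n.+1, n)) :
  ~ (forall v : 'rV_n.+1, v *m A = 0 -> v = 0).
Proof.
move=> inj.
pose B : 'M[R]_n.+1 := \matrix_(i, j) (if unlift ord_max j is Some k then A i k else 0).
have injB m (C : 'M_(m, n.+1)) : C *m B = 0 -> C = 0.
  move=> CB; apply/row_matrixP => i; rewrite row0; apply: inj; apply/rowP => j.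
  have /matrixP/(_ i (lift ord_max j)) := CB; rewrite !mxE => CBij.
  rewrite -[RHS]CBij.
  by apply: eq_bigr => k _; rewrite !mxE liftK.
suff kill (p : {poly R}) : p \is monic -> horner_mx B p <> 0.
  exact: kill (char_poly_monic B) (Cayley_Hamilton B).
elim/poly_ind: p => [|p c IH]; first by rewrite monicE lead_coef0 eq_sym oner_eq0.
move=> pm; rewrite rmorphD rmorphM /= horner_mx_X horner_mx_C => pB.
have c0 : c = 0.
  have /matrixP/(_ ord_max ord_max) := pB; rewrite !mxE eqxx mulr1n big1 ?add0r //.
  by move=> k _; rewrite !mxE unlift_none mulr0.
move: pB pm; rewrite c0 polyC0 addr0 raddf0 addr0 => /injB pB.
by rewrite monicE lead_coefMX -monicE => /IH.
Qed.

End StrongRank.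

Section FunctionModules.
Variable R : comNzRingType.

Section Extension.
Variables (J K : Type) (c : J -> K) (ci : injective c).

Definition ext_fun (u : J -> R^o) (k : K) : R^o :=
  if pselect (exists j, c j = k) is left h then u (projT1 (cid h)) else 0.

Lemma ext_fun_in u j : ext_fun u (c j) = u j.
Proof.
rewrite /ext_fun; case: pselect => [h|[]]; last by exists j.
by case: cid => i /= /ci ->.
Qed.

Lemma ext_fun_out u k : ~ (exists j, c j = k) -> ext_fun u k = 0.
Proof. by rewrite /ext_fun; case: pselect. Qed.

Lemma ext_fun_linear : linear ext_fun.
Proof.
move=> a u v; apply/funext => k; rewrite /GRing.add /GRing.scale /= /ext_fun.
by case: pselect => // _; rewrite scaler0 addr0.
Qed.

Definition ext : {linear (J -> R^o) -> (K -> R^o)} := mk_linear ext_fun_linear.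

End Extension.

Definition delta (K : choiceType) (k : K) : K -> R^o := fun j => (j == k)%:R.

Lemma ext_delta (J K : choiceType) (c : J -> K) (ci : injective c) j :
  ext c (delta j) = delta (c j).
Proof.
apply/funext => k; rewrite /delta; have [[i <-]|nk] := pselect (exists i, c i = k).
  by rewrite [LHS](ext_fun_in ci) /= -(inj_eq ci).
by rewrite [LHS]ext_fun_out //; case: eqP => // kc; case: nk; exists j.
Qed.

(** On vectors supported on [n.+1] chosen coordinates, [theta] acts as an [n.+1] by [n] matrix
    without left kernel. *)
Lemma rank_bound (I K : Type) (n : nat) (theta : {linear (K -> R^o) -> (I -> R^o)})
    (b : 'I_n -> I) (c : 'I_n.+1 -> K) :
  injective theta -> surjective b -> injective c -> False.
Proof.
move=> ti bs ci; pose A : 'M[R]_(n.+1, n) := \matrix_(i, j) theta (ext c (delta i)) (b j).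
apply: (@strong_rank R n A) => v vA; pose u : 'I_n.+1 -> R^o := fun i => v 0 i.
have uE : u = \sum_i (v 0 i) *: delta i.
  apply/funext => j; rewrite fct_sumE (bigD1 j) //= big1 ?addr0 => [|i ij].
    by rewrite -[RHS]/(v 0 j * delta j j) /delta eqxx mulr1.
  by rewrite -[LHS]/(v 0 i * delta i j) /delta eq_sym (negbTE ij) mulr0.
have : theta (ext c u) = 0.
  apply/funext => i; have [j <-] := bs i; have /rowP/(_ j) := vA.
  rewrite !mxE => vAj; rewrite -[RHS]vAj.
  rewrite uE !linear_sum fct_sumE; apply: eq_bigr => k _.
  by rewrite !linearZ !mxE.
rewrite -(linear0 theta) => /ti u0; apply/rowP => i; rewrite mxE.
by rewrite -[LHS]/(u i) -(ext_fun_in ci u) -[LHS]/(ext c u (c i)) u0.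
Qed.

Lemma finite_rank (I K : Type) (theta : {linear (K -> R^o) -> (I -> R^o)}) :
  injective theta -> finite_set [set: I] -> [set: K] #<= [set: I].
Proof.
move=> ti /finite_setP[n In]; apply: contrapT => nle.
have nI : [set: 'I_n] #= [set: I].
  by apply: card_esym; apply: card_eq_trans In _; apply: card_II.
have [f [g _ gK]] := card_bijP nI.
pose b j := val (f (SigSub (mem_setT j))).
have bs : surjective b.
  move=> i; exists (val (g (SigSub (mem_setT i)))).
  rewrite /b (_ : SigSub _ = g (SigSub (mem_setT i))) ?gK //.
  exact: val_inj.
have /card_leT_inj[c ci] : [set: 'I_n.+1] #<= [set: K].
  apply: (@card_le_trans _ _ _ `I_n.+1).
    by have /card_eqPle[] := @card_II n.+1.
  have [fK|/infiniteP iK] := pselect (finite_set [set: K]); last first.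
    by apply: card_le_trans iK; apply: subset_card_le.
  have [m Km] := (finite_setP _).1 fK; have /card_eqPle[K1 K2] := Km.
  apply: card_le_trans K2; rewrite card_le_II ltnNge; apply/negP => mn.
  apply: nle; apply: card_le_trans K1 _; have /card_eqPle[_ h] := In.
  by apply: card_le_trans h; rewrite card_le_II.
exact: rank_bound ti bs ci.
Qed.

End FunctionModules.

Theorem slender_card (S : comNzRingType) (I K : choiceType)
    (theta : {linear (K -> S^o) -> (I -> S^o)}) :
  slender S -> injective theta -> exists h : K -> I, injective h.
Proof.
move=> sS ti; have [fI|nfI] := pselect (finite_set [set: I]).
  exact: card_leT_inj (finite_rank ti fI).
(* Infinitely many such [k] contain a sequence [c]; extension by zero along [c] followed by the
   [i]-th coordinate of [theta] is a functional on [S^omega] that contradicts slenderness. *)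
have fin i : finite_set [set k | theta (delta S k) i <> 0].
  apply: contrapT => /card_nat_le_inj[c [ci hc]]; apply: infinite_nat.
  have fl : linear (fun u => theta (ext S c u) i).
    by move=> a u v; rewrite !linearP.
  apply: sub_finite_set (sS (mk_linear fl)) => n _; rewrite /mkset.
  suff -> : mk_linear fl (unit_vector S n) = theta (delta S (c n)) i by apply: hc.
  by rewrite -(ext_delta S ci).
(* Injectivity keeps the image of each unit vector nonzero; picking a coordinate that witnesses this
   gives a map [r] whose fibres are finite by [fin]. *)
have /choice[r hr] : forall k, exists i, theta (delta S k) i <> 0.
  move=> k; apply: contrapT => /forallNP h.
  have : delta S k = 0.
    apply: ti; rewrite linear0; apply/funext => i; exact: contrapT (h i).
  move=> /(congr1 (@^~ k)); rewrite /delta eqxx => /eqP; exact/negP/oner_neq0.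
apply: (finite_fibers_inj (r := r)) => // i.
by apply: sub_finite_set (fin i) => k /= <-; apply: hr.
Qed.

(** * Change of rings *)

Section RowTransport.
Variables (R : comNzRingType) (I K : Type).
Variable theta : {linear (K -> R^o) -> (I -> R^o)}.

(** This is the [n]-fold power of [theta] under [(R^n)^K = (R^K)^n]. It commutes with matrices,
    hence descends to cokernels. *)
Definition row_map n (x : K -> 'rV[R]_n) (i : I) : 'rV[R]_n :=
  \row_j theta (fun k => x k 0 j) i.

Lemma row_map_linear n a (x y : K -> 'rV[R]_n) i :
  row_map (fun k => a *: x k + y k) i = a *: row_map x i + row_map y i.
Proof.
apply/rowP => j; rewrite !mxE.
rewrite (_ : (fun k => _) = a *: (fun k => x k 0 j : R^o) + (fun k => y k 0 j : R^o)).
  by rewrite linearP.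
by apply/funext => k; rewrite !mxE.
Qed.

Lemma row_map_mul m n (A : 'M[R]_(m, n)) (x : K -> 'rV[R]_m) i :
  row_map (fun k => x k *m A) i = row_map x i *m A.
Proof.
apply/rowP => j; rewrite !mxE.
rewrite (_ : (fun k => _) = \sum_l A l j *: (fun k => x k 0 l : R^o)).
  rewrite linear_sum fct_sumE; apply: eq_bigr => l _.
  by rewrite linearZ !mxE mulrC.
by apply/funext => k; rewrite fct_sumE mxE; apply: eq_bigr => l _; rewrite mulrC.
Qed.

Lemma row_map_comp m n (f : {linear 'rV[R]_m -> 'rV[R]_n}) (x : K -> 'rV[R]_m) i :
  row_map (fun k => f (x k)) i = f (row_map x i).
Proof.
rewrite -mul_rV_lin1 -row_map_mul; congr (row_map _ i).
by apply/funext => k; rewrite mul_rV_lin1.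
Qed.

End RowTransport.

Section BaseChange.
Variables (R S : comNzRingType) (phi : {rmorphism R -> S}).
Variables (m n : nat) (f : {linear 'rV[R]_m -> 'rV[R]_n}).
Variable g : {linear 'rV[R]_n -> scalar_restr phi}.
Hypothesis gs : surjective g.
Hypothesis gf : forall v, g v = 0 <-> exists u, f u = v.

Let sigma (y : S) : 'rV[R]_n := projT1 (cid (gs y)).
Let sigmaK y : g (sigma y) = y. Proof. by rewrite /sigma; case: cid. Qed.

Section Map.
Variables (I K : Type) (theta : {linear (K -> R^o) -> (I -> R^o)}).

(** [S^K] is the cokernel of [(R^m)^K -> (R^n)^K], and this is the map that [theta] induces on
    cokernels, computed on the lifts chosen by [sigma], which is only a section of sets. *)
Definition base_change (u : K -> S^o) (i : I) : S^o := g (row_map theta (sigma \o u) i).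

(** Independence of the lift: two lifts differ pointwise by values of [f], and [row_map] commutes
    with [f]. *)
Lemma base_changeE (x : K -> 'rV[R]_n) :
  base_change (fun k => g (x k)) = (fun i => g (row_map theta x i)).
Proof.
apply/funext => i; apply/eqP; rewrite -subr_eq0 /base_change.
have /choice[w hw] k : exists w, f w = sigma (g (x k)) - x k.
  by apply/gf; rewrite linearB sigmaK; apply: subrr.
rewrite -[X in X == 0](linearB g) -scaleN1r addrC -row_map_linear.
rewrite (_ : (fun k => _) = fun k => f (w k)).
  by rewrite row_map_comp; apply/eqP/gf; eexists.
by apply/funext => k; rewrite hw scaleN1r addrC.
Qed.

(** Multiplication by [s] on [S] lifts to a matrix [A] on [R^n], with which [row_map] commutes; this
    yields linearity over [S] and not just over [R]. *)
Lemma base_change_linear : linear base_change.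
Proof.
move=> s u v.
pose A : 'M[R]_n := \matrix_(l, j) sigma (s * (g (delta_mx 0 l) : S)) 0 j.
have gA (x : 'rV[R]_n) : g (x *m A) = s * (g x : S).
  rewrite mulmx_sum_row linear_sum [in RHS](row_sum_delta x) [in RHS]linear_sum mulr_sumr.
  apply: eq_bigr => l _; rewrite !linearZ /=.
  rewrite (_ : row l A = sigma (s * (g (delta_mx 0 l) : S))).
    by rewrite sigmaK; apply: mulrCA.
  by apply/rowP => j; rewrite !mxE.
have uE : u = fun k => g (sigma (u k)) by apply/funext => k; rewrite sigmaK.
have vE : v = fun k => g (sigma (v k)) by apply/funext => k; rewrite sigmaK.
have -> : s *: u + v = fun k => g (1 *: (sigma (u k) *m A) + sigma (v k)).
  by apply/funext => k; rewrite linearP gA !sigmaK scale1r.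
rewrite base_changeE; apply/funext => i.
by rewrite row_map_linear row_map_mul linearP gA scale1r.
Qed.

End Map.

Lemma base_changeK (I K : Type) (theta : {linear (K -> R^o) -> (I -> R^o)})
    (theta' : {linear (I -> R^o) -> (K -> R^o)}) :
  cancel theta theta' -> cancel (base_change theta) (base_change theta').
Proof.
move=> tK u; rewrite [LHS](base_changeE theta' (row_map theta (sigma \o u))).
apply/funext => k; rewrite -[RHS]sigmaK; congr (g _); apply/rowP => j; rewrite mxE.
rewrite (_ : (fun i => _) = theta (fun k => sigma (u k) 0 j)) ?tK //.
by apply/funext => i; rewrite mxE.
Qed.

End BaseChange.

(** The inverse of [theta] is transported along with it, which is how the induced map is seen to be
    injective. *)
Theorem w_slender_card (R : comNzRingType) (I K : choiceType) :
  w_slender R -> isomorphic (K -> R^o) (I -> R^o) ->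
  exists h : K -> I, injective h.
Proof.
move=> [S [phi [sS [m [n [f [g [gs gf]]]]]]]] /isoP[theta [theta' [tK _]]].
apply: (slender_card (theta := mk_linear (base_change_linear gs gf theta))) => //.
exact: can_inj (base_changeK gs gf tK).
Qed.

(** * Dual modules over a connected ring *)

Section Duals.
Variable R : comNzRingType.
Implicit Types M N : lmodType R.

Lemma dual_map_linear M N (f : {linear M -> N}) :
  linear (fun phi : dual N => (phi : {linear N -> R^o}) \o f : dual M).
Proof. by move=> a phi psi; apply: dualP. Qed.

Definition dual_map M N (f : {linear M -> N}) : {linear dual N -> dual M} :=
  mk_linear (dual_map_linear f).

Lemma dual_iso M N : isomorphic M N -> isomorphic (dual M) (dual N).
Proof.
move=> /isoP[f [g [fK gK]]]; apply: (@isoI _ _ _ (dual_map g) (dual_map f)).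
  by move=> phi; apply: dualP => x /=; rewrite fK.
by move=> phi; apply: dualP => x /=; rewrite gK.
Qed.

Lemma dual_map_inj M N (f : {linear M -> N}) : surjective f -> injective (dual_map f).
Proof.
move=> sf phi psi h; apply: dualP => y; have [x <-] := sf y.
exact: (congr1 (fun g : dual M => (g : {linear M -> R^o}) x) h).
Qed.

Lemma dual_fs (I : choiceType) : isomorphic (dual (fs I R^o)) (I -> R^o).
Proof.
have hl : linear (fun (phi : dual (fs I R^o)) (i : I) =>
    (phi : {linear fs I R^o -> R^o}) (single R i)) by [].
exists (mk_linear hl); exists (fun u => fs_lift u : dual (fs I R^o)).
  by move=> phi; apply: dualP; apply: fs_lin_ext => i; rewrite fs_lift_single.
by move=> u; apply/funext => i; rewrite mk_linearE fs_lift_single.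
Qed.

Lemma fin_gen_fs_surj M : fin_gen M -> exists n (q : {linear fs 'I_n R^o -> M}), surjective q.
Proof.
case=> l hl; exists (size l), (fs_lift (fun i : 'I_(size l) => l`_i)) => x.
have [|y yl|v _ <-] := hl x (range (fs_lift (fun i : 'I_(size l) => l`_i))).
- exact: submod_range.
- have yi : (index y l < size l)%N by rewrite index_mem.
  by exists (single R (Ordinal yi)) => //; rewrite fs_lift_single nth_index.
by exists v.
Qed.

(** Through a finite dual basis [x = sum_i f i x *: p i]: an element [Psi] of the bidual is
    evaluation at [sum_i Psi (f i) *: p i]. *)
Lemma bidual_iso M : fin_gen M -> projective M -> isomorphic M (dual (dual M)).
Proof.
move=> /fin_gen_fs_surj[n [q sq]] pM; have [s sK] := projective_section pM sq.
have evl x : linear (fun phi : dual M => (phi : {linear M -> R^o}) x) by [].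
have evL : linear (fun x => mk_linear (evl x) : dual (dual M)).
  by move=> a x y; apply: dualP => phi; rewrite mk_linearE linearP.
have fl i : linear (fun x => fcoef (s x) i : R^o) by move=> a x y; rewrite linearP.
pose f i : dual M := mk_linear (fl i); pose p i := q (single R i).
have sE x : x = \sum_i (fcoef (s x) i : R) *: p i.
  rewrite -{1}(sK x) -{1}(fs_lift_single_id (s x)).
  rewrite (@fs_liftE _ _ _ _ _ (enum 'I_n)) ?enum_uniq // => [|i _]; last by rewrite mem_enum.
  by rewrite big_enum linear_sum; apply: eq_bigr => i _; rewrite linearZ.
apply: (bij_iso (f := mk_linear evL)).
  apply: raddf_inj => x ev0; rewrite (sE x) big1 // => i _.
  have := congr1 (fun h : dual (dual M) => (h : {linear dual M -> R^o}) (f i)) ev0.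
  by rewrite /= => ->; rewrite scale0r.
move=> Psi; pose ps := Psi : {linear dual M -> R^o}.
exists (\sum_i (ps (f i) : R) *: p i); apply: dualP => phi.
pose ph := phi : {linear M -> R^o}.
have phiE : phi = \sum_i (ph (p i) : R) *: f i.
  apply: dualP => x; rewrite -/ph {1}(sE x) linear_sum.
  rewrite (big_morph (fun h : dual M => (h : {linear M -> R^o}) x) (id1 := 0) (op1 := +%R)) //.
  by apply: eq_bigr => i _; rewrite linearZ [LHS]mulrC.
transitivity (ph (\sum_i (ps (f i) : R) *: p i)); first by [].
transitivity (ps (\sum_i (ph (p i) : R) *: f i)); last by rewrite -phiE.
rewrite !linear_sum.
by apply: eq_bigr => i _; rewrite !linearZ [LHS]mulrC.
Qed.

Lemma free_module_fs M : free_module M -> exists I : choiceType, isomorphic M (fs I R^o).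
Proof.
case=> B [gB iB]; exists {x : M | `[< B x >]}; apply: iso_sym.
pose j (x : {x : M | `[< B x >]}) : M := val x.
apply: (bij_iso (f := fs_lift j)) => [|x].
  apply: raddf_inj => v v0.
  pose c (b : M) : R := if insub b is Some i then fcoef v i else 0.
  have cj i : c (j i) = fcoef v i by rewrite /c /j valK.
  have jB (b : M) : b \in map j (fsupp v) -> B b.
    by move=> /mapP[i _ ->]; apply/asboolP; apply: (valP i).
  have uj : uniq (map j (fsupp v)) by rewrite map_inj_uniq ?fsupp_uniq //; apply: val_inj.
  have c0 : \sum_(b <- map j (fsupp v)) c b *: b = 0.
    rewrite big_map; apply: etrans v0; rewrite -[RHS]/(fs_lift j v) fs_lift_supp.
    by apply: eq_bigr => k _; rewrite cj.
  apply: fs_ext => i; have [vi|] := boolP (i \in fsupp v).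
    by rewrite -cj (iB _ c uj jB c0) ?map_f.
  by rewrite mem_fsupp => /negbNE/eqP.
have [s [c [sB ->]]] := gB x; suff [v _ hv] : range (fs_lift j) (\sum_(b <- s) c b *: b).
  by exists v.
rewrite big_seq; apply: submod_sum => [|b bs]; first exact: submod_range.
apply: submodZ; first exact: submod_range.
exists (single R (exist _ b (asboolT (sB b bs)))) => //.
by rewrite fs_lift_single.
Qed.

Lemma fs_equipotent (I K : choiceType) (h : K -> I) (h' : I -> K) :
  injective h -> injective h' -> isomorphic (fs I R^o) (fs K R^o).
Proof.
move=> /inj_card_leT KI /inj_card_leT IK.
have /card_bijP[f bf] := Cantor_Bernstein KI IK.
pose b k := val (f (SigSub (mem_setT k))).
apply: (@fs_reindex R I K b); case: bf => g fin_gen gf.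
exists (fun i => val (g (SigSub (mem_setT i)))) => x.
  by rewrite /b (_ : SigSub _ = f (SigSub (mem_setT x))) ?fin_gen //; apply: val_inj.
by rewrite /b (_ : SigSub _ = g (SigSub (mem_setT x))) ?gf //; apply: val_inj.
Qed.

End Duals.

(** A surjection [R^n -> M] dualizes to an injection, so [R^K] embeds in [R^n]. *)
Lemma fin_gen_dual_not_infinite (R : comNzRingType) (M : lmodType R) (K : choiceType)
    (f : {linear dual (fs K R^o) -> dual M}) :
  fin_gen M -> injective f -> finite_set [set: K].
Proof.
move=> /fin_gen_fs_surj[n [q sq]] fi.
have [a [a' [aK _]]] := isoP (dual_fs R 'I_n).
have [b [b' [_ b'K]]] := isoP (dual_fs R K).
have ti : injective (a \o (dual_map q \o (f \o b')) : {linear _ -> _}).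
  apply: inj_comp; first exact: can_inj aK.
  apply: inj_comp; first exact: dual_map_inj.
  by apply: inj_comp => //; apply: can_inj b'K.
exact: card_le_finite (finite_rank ti finite_finset) finite_finset.
Qed.

(** Two finitely generated modules are recovered from their biduals, the strong rank condition
    excludes the mixed cases, and w-slenderness compares the ranks of two infinite free modules. *)
Lemma iso_dual_iso_connected (R : comNzRingType) (P Q : lmodType R) :
  noetherian R -> connected_ring R -> w_slender R -> projective P -> projective Q ->
  isomorphic (dual P) (dual Q) -> isomorphic P Q.
Proof.
move=> hR cR wR pP pQ dPQ.
have [fP|/(big_projective_free hR cR pP)[I [iI PI]]] := pselect (fin_gen P);
  have [fQ|/(big_projective_free hR cR pQ)[K [iK QK]]] := pselect (fin_gen Q).
- apply: iso_trans (bidual_iso fP pP) _; apply: iso_sym.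
  exact: iso_trans (bidual_iso fQ pQ) (dual_iso (iso_sym dPQ)).
- case: iK; have [f [g [_ gK]]] := isoP (iso_trans dPQ (dual_iso QK)).
  exact: fin_gen_dual_not_infinite fP (can_inj gK).
- case: iI; have [f [g [_ gK]]] := isoP (iso_trans (iso_sym dPQ) (dual_iso PI)).
  exact: fin_gen_dual_not_infinite fQ (can_inj gK).
have KI : isomorphic (K -> R^o) (I -> R^o).
  apply: iso_trans (iso_sym (dual_fs R K)) _; apply: iso_trans _ (dual_fs R I).
  apply: iso_trans (dual_iso (iso_sym QK)) _.
  exact: iso_trans (iso_sym dPQ) (dual_iso PI).
have [h hi] := w_slender_card wR KI; have [h' h'i] := w_slender_card wR (iso_sym KI).
apply: iso_trans PI _; apply: iso_trans _ (iso_sym QK).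
exact: fs_equipotent hi h'i.
Qed.

Lemma iso_surj (R : comNzRingType) (P Q P' Q' : lmodType R) :
  isomorphic P P' -> isomorphic Q Q' ->
  (exists g : {linear P' -> Q'}, surjective g) -> exists g : {linear P -> Q}, surjective g.
Proof.
move=> /isoP[a [a' [_ a'K]]] /isoP[b [b' [bK _]]] [g sg].
exists (b' \o (g \o a)) => y; have [x xy] := sg (b y).
by exists (a' x) => /=; rewrite a'K xy bK.
Qed.

Lemma dual_inj_functions (R : comNzRingType) (P Q : lmodType R) (I K : choiceType) :
  isomorphic P (fs I R^o) -> isomorphic Q (fs K R^o) ->
  (exists f : {linear dual Q -> dual P}, injective f) ->
  exists theta : {linear (K -> R^o) -> (I -> R^o)}, injective theta.
Proof.
move=> PI QK [f fi].
have [a [a1 [aK _]]] := isoP (iso_trans (dual_iso PI) (dual_fs R I)).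
have [b1 [b [_ bK]]] := isoP (iso_trans (dual_iso QK) (dual_fs R K)).
exists (a \o (f \o b)); apply: inj_comp; first exact: can_inj aK.
by apply: inj_comp => //; apply: can_inj bK.
Qed.

(** QS and Bass's theorem make both modules free; an injection of the index sets then gives the
    surjection, by restricting coordinates. *)
Lemma inj_dual_surj_connected (R : comNzRingType) (P Q : lmodType R) :
  noetherian R -> connected_ring R -> slender R -> QS R -> projective P -> projective Q ->
  (exists f : {linear dual Q -> dual P}, injective f) ->
  exists g : {linear P -> Q}, surjective g.
Proof.
move=> hR cR sR qR pP pQ hf.
have free (M : lmodType R) : projective M -> exists I : choiceType, isomorphic M (fs I R^o).
  move=> pM; have [fM|/(big_projective_free hR cR pM)[I [_ MI]]] := pselect (fin_gen M).
    by apply: free_module_fs; apply: qR => //; apply/fin_genP.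
  by exists I.
have [I PI] := free P pP; have [K QK] := free Q pQ.
have [theta ti] := dual_inj_functions PI QK hf.
have [h hi] := slender_card sR ti.
by apply: iso_surj PI QK _; exists (fs_comp R^o hi); apply: fs_comp_surj.
Qed.

(** * Connected components *)

(* A ring factor [S] of [R]: [flift] is the (non-unital) section of the projection
   vanishing on the complementary factor, so [flift 1] is the idempotent cutting
   out [S]. *)
Record ring_factor (R S : comNzRingType) := RingFactor {
  fproj : {rmorphism R -> S};
  flift : S -> R;
  fliftK : cancel flift fproj;
  fliftM : forall r a, flift (fproj r * a) = r * flift a }.

Section RingFactor.
Variables (R S : comNzRingType) (c : ring_factor R S).
Local Notation pr := (fproj c).
Local Notation li := (flift c).

Definition fidem : R := li 1.

Lemma flift_proj r : li (pr r) = r * fidem.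
Proof. by rewrite -fliftM mulr1. Qed.

Lemma fliftE a : li a = li a * fidem.
Proof. by rewrite -flift_proj fliftK. Qed.

Lemma fliftD a b : li (a + b) = li a + li b.
Proof. by rewrite -{1}(fliftK c a) -{1}(fliftK c b) -rmorphD flift_proj mulrDl -!fliftE. Qed.

Lemma flift_mul a b : li (a * b) = li a * li b.
Proof. by rewrite -{1}(fliftK c a) fliftM. Qed.

Lemma fproj_idem : pr fidem = 1.
Proof. exact: fliftK. Qed.

Lemma fidemK : fidem * fidem = fidem.
Proof. by rewrite -flift_proj fproj_idem. Qed.

Section Component.
Variable M : lmodType R.

Lemma comp_submodule : submodule [set x : M | fidem *: x = x].
Proof.
split=> [|a x y /= ex ey]; rewrite /= ?scaler0 //.
by rewrite scalerDr ey scalerA mulrC -scalerA ex.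
Qed.

(** The summand [e M] for the idempotent [e = fidem]. The fresh name keeps its scaling by [S] apart
    from the scaling by [R] of the subtype. *)
Definition comp : Type := subM comp_submodule.
HB.instance Definition _ := GRing.Zmodule.copy comp (subM comp_submodule).

Lemma comp_scale_subproof a (x : comp) : [set x : M | fidem *: x = x] (li a *: val x).
Proof. by rewrite /= scalerA mulrC -fliftE. Qed.

Definition comp_scale (a : S) (x : comp) : comp :=
  toSub comp_submodule (comp_scale_subproof a x).

Lemma comp_scaleA a b x : comp_scale a (comp_scale b x) = comp_scale (a * b) x.
Proof. by apply: val_inj; rewrite /= scalerA flift_mul. Qed.
Lemma comp_scale1 : left_id 1 comp_scale.
Proof. by move=> x; apply: val_inj; apply: (subMP x). Qed.
Lemma comp_scaleDr : right_distributive comp_scale +%R.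
Proof. by move=> a x y; apply: val_inj; rewrite /= scalerDr. Qed.
Lemma comp_scaleDl x : {morph comp_scale^~ x : a b / a + b}.
Proof. by move=> a b; apply: val_inj; rewrite /= fliftD scalerDl. Qed.

HB.instance Definition _ := GRing.Zmodule_isLmodule.Build S comp
  comp_scaleA comp_scale1 comp_scaleDr comp_scaleDl.

Definition cval (x : comp) : M := val x.

Lemma cvalD x y : cval (x + y) = cval x + cval y. Proof. by []. Qed.
Lemma cvalZ a x : cval (a *: x) = li a *: cval x. Proof. by []. Qed.
Lemma cval_idem x : fidem *: cval x = cval x. Proof. exact: (subMP x). Qed.
Lemma cval_inj : injective cval. Proof. exact: val_inj. Qed.

Lemma cproj_subproof (x : M) : [set x : M | fidem *: x = x] (fidem *: x).
Proof. by rewrite /= scalerA fidemK. Qed.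

Definition cproj (x : M) : comp := toSub comp_submodule (cproj_subproof x).

Lemma cprojE x : cval (cproj x) = fidem *: x. Proof. by []. Qed.

Lemma cprojK x : cproj (cval x) = x.
Proof. by apply: cval_inj; rewrite cprojE cval_idem. Qed.

Lemma cprojP a x y : cproj (a *: x + y) = pr a *: cproj x + cproj y.
Proof.
apply: cval_inj; rewrite cvalD cvalZ !cprojE scalerDr !scalerA.
by rewrite flift_proj -mulrA fidemK mulrC.
Qed.

End Component.

Section CompMap.
Variables (M N : lmodType R) (f : {linear M -> N}).

Lemma comp_map_subproof (x : comp M) : [set x : N | fidem *: x = x] (f (cval x)).
Proof. by rewrite /= -linearZ /= cval_idem. Qed.

Lemma comp_map_linear :
  linear (fun x => toSub (comp_submodule N) (comp_map_subproof x) : comp N).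
Proof. by move=> a x y; apply: val_inj; rewrite /= linearP. Qed.

Definition comp_map : {linear comp M -> comp N} := mk_linear comp_map_linear.

Lemma comp_mapE x : cval (comp_map x) = f (cval x). Proof. by []. Qed.

Lemma comp_map_inj : injective f -> injective comp_map.
Proof. by move=> fi x y /(congr1 (@cval N)); rewrite !comp_mapE => /fi/cval_inj. Qed.

End CompMap.

Lemma comp_iso (M N : lmodType R) : isomorphic M N -> isomorphic (comp M) (comp N).
Proof.
move=> /isoP[f [g [fK gK]]]; apply: (@isoI _ _ _ (comp_map f) (comp_map g)) => x;
  by apply: cval_inj; rewrite !comp_mapE ?fK ?gK.
Qed.

Section Restriction.
Variable A : lmodType S.

Definition restr_mod : Type := A.
HB.instance Definition _ := GRing.Zmodule.copy restr_mod A.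

Definition restr_mod_scale (r : R) (x : restr_mod) : restr_mod := pr r *: (x : A).

Lemma restr_mod_scaleA a b x :
  restr_mod_scale a (restr_mod_scale b x) = restr_mod_scale (a * b) x.
Proof. by rewrite /restr_mod_scale rmorphM scalerA. Qed.
Lemma restr_mod_scale1 : left_id 1 restr_mod_scale.
Proof. by move=> x; rewrite /restr_mod_scale rmorph1 scale1r. Qed.
Lemma restr_mod_scaleDr : right_distributive restr_mod_scale +%R.
Proof. by move=> a x y; apply: scalerDr. Qed.
Lemma restr_mod_scaleDl x : {morph restr_mod_scale^~ x : a b / a + b}.
Proof. by move=> a b; rewrite /restr_mod_scale rmorphD; apply: scalerDl. Qed.

HB.instance Definition _ := GRing.Zmodule_isLmodule.Build R restr_mod
  restr_mod_scaleA restr_mod_scale1 restr_mod_scaleDr restr_mod_scaleDl.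

End Restriction.

(** Composing with [cproj] turns a lifting problem over [S] into one for [M] over [R]. The lift
    restricted along [cval] is [S]-linear because [fproj] undoes [flift]. *)
Lemma comp_projective (M : lmodType R) : projective M -> projective (comp M).
Proof.
move=> pM A B g f sg.
have gl : linear (g : restr_mod A -> restr_mod B) by move=> a x y; apply: linearP.
have fl : linear (fun x : M => f (cproj x) : restr_mod B).
  by move=> a x y; rewrite cprojP linearP.
have [h hE] := pM _ _ (mk_linear gl) (mk_linear fl) sg.
have hl : linear (fun x : comp M => h (cval x) : A).
  move=> a x y; rewrite cvalD cvalZ linearP.
  by rewrite -[X in X + _]/(pr (li a) *: (h (cval x) : A)) fliftK.
exists (mk_linear hl) => x; apply: etrans (hE (cval x)) _.
by rewrite mk_linearE cprojK.
Qed.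

(** A functional fixed by [e] takes values in [e R], which is [S], and only sees the component [e M]
    of its argument. *)
Lemma comp_dual (M : lmodType R) : isomorphic (comp (dual M)) (dual (comp M)).
Proof.
pose app (psi : dual M) : {linear M -> R^o} := psi.
have psiE (psi : comp (dual M)) x : fidem * app (cval psi) x = app (cval psi) x.
  exact: (congr1 (fun h : dual M => app h x) (cval_idem psi)).
have al psi : linear (fun x : comp M => pr (app (cval psi) (cval x)) : S^o).
  by move=> a x y; rewrite cvalD cvalZ linearP rmorphD rmorphM fliftK.
have aL : linear (fun psi : comp (dual M) => mk_linear (al psi) : dual (comp M)).
  move=> a u v; apply: dualP => x.
  transitivity (pr (li a * app (cval u) (cval x) + app (cval v) (cval x))); first by [].
  by rewrite rmorphD rmorphM fliftK.
have bl (phi : dual (comp M)) :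
    linear (fun m : M => li ((phi : {linear comp M -> S^o}) (cproj m)) : R^o).
  by move=> a x y; rewrite cprojP linearP fliftD fliftM.
have be phi : [set psi : dual M | fidem *: psi = psi] (mk_linear (bl phi)).
  by apply: dualP => m; rewrite -[LHS]/(fidem * _) mulrC mk_linearE -fliftE.
exists (mk_linear aL); exists (fun phi => toSub (comp_submodule (dual M)) (be phi)).
  move=> psi; apply: cval_inj; apply: dualP => m.
  rewrite -[LHS]/(li (pr (app (cval psi) (fidem *: m)))) flift_proj.
  have -> : app (cval psi) (fidem *: m) = app (cval psi) m by rewrite linearZ; apply: psiE.
  by rewrite mulrC psiE.
move=> phi; apply: dualP => x.
by rewrite -[LHS]/(pr (li ((phi : {linear comp M -> S^o}) (cproj (cval x))))) cprojK fliftK.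
Qed.

(** By linearity [theta] commutes with [e], so it restricts to a map from [e R^K = S^K] to
    [e R^I = S^I]. *)
Lemma factor_functions (I K : Type) (theta : {linear (K -> R^o) -> (I -> R^o)}) :
  injective theta -> exists theta' : {linear (K -> S^o) -> (I -> S^o)}, injective theta'.
Proof.
move=> ti; have hl : linear (fun u : K -> S^o =>
    (fun i => pr (theta (fun k => li (u k)) i)) : I -> S^o).
  move=> a u v; apply/funext => i.
  rewrite (_ : (fun k => _) = li a *: (fun k => li (u k) : R^o) + (fun k => li (v k) : R^o)).
    by rewrite linearP rmorphD rmorphM fliftK.
  by apply/funext => k; rewrite fliftD flift_mul.
exists (mk_linear hl); apply: raddf_inj => u u0.
have eu : fidem *: (fun k => li (u k) : R^o) = (fun k => li (u k)).
  by apply/funext => k; rewrite -[LHS]/(fidem * _) mulrC -fliftE.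
have t0 : theta (fun k => li (u k)) = 0.
  apply/funext => i; rewrite -eu linearZ -[LHS]/(fidem * _) mulrC -flift_proj.
  have -> : pr (theta (fun k => li (u k)) i) = 0 := congr1 (@^~ i) u0.
  by rewrite -(mul0r 0) -(rmorph0 pr) fliftM mul0r.
have lu0 : (fun k => li (u k)) = 0 :> (K -> R^o) by apply: ti; rewrite linear0.
apply/funext => k; rewrite -[LHS](fliftK c).
by rewrite (congr1 (@^~ k) lu0); apply: rmorph0.
Qed.

End RingFactor.

Arguments fidem {R S} c : simpl never.

Section Decomposition.
Variables (R : comNzRingType) (D : decomposition R).
Local Notation proj := (component_proj (d := D)).

Lemma component_inj r r' : (forall k, proj k r = proj k r') -> r = r'.
Proof.
move=> h; apply: (bij_inj (component_proj_bij D)).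
exact: functional_extensionality_dep.
Qed.

Lemma component_lift_ex k (a : component (d := D) k) :
  exists r, proj k r = a /\ forall j, j != k -> proj j r = 0.
Proof.
have [g _ gK] := component_proj_bij D.
(* The value [a] at [k] and 0 elsewhere; the component types depend on the index, so [a] is
   transported along [k = j]. *)
pose fam j : component (d := D) j :=
  if k =P j is ReflectT kj then eq_rect k (fun i => component (d := D) i : Type) a j kj else 0.
have E j : proj j (g fam) = fam j.
  exact: (congr1 (fun F : forall j, component j => F j) (gK fam)).
exists (g fam); split=> [|j jk]; rewrite E /fam.
  by case: eqP => // kk; rewrite (eq_axiomK kk).
by case: eqP => // kj; rewrite kj eqxx in jk.
Qed.

Let lift_ k a := projT1 (cid (@component_lift_ex k a)).
Let lift_in k a : proj k (lift_ a) = a.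
Proof. by rewrite /lift_; case: cid => r []. Qed.
Let lift_out k a j : j != k -> proj j (@lift_ k a) = 0.
Proof. by rewrite /lift_; case: cid => r [] /= _; apply. Qed.

Let lift_mul k r (a : component (d := D) k) : lift_ (proj k r * a) = r * lift_ a.
Proof.
apply: component_inj => j; rewrite rmorphM; have [->|jk] := eqVneq j k.
  by rewrite !lift_in.
by rewrite !lift_out // mulr0.
Qed.

Definition factor k : ring_factor R (component (d := D) k) :=
  RingFactor (@lift_in k) (@lift_mul k).

Lemma factor_orth j k : j != k -> fidem (factor j) * fidem (factor k) = 0.
Proof.
move=> jk; apply: component_inj => i; rewrite rmorphM rmorph0.
have [ij|ij] := eqVneq i j; last by rewrite [X in X * _]lift_out ?mul0r.
by rewrite [X in _ * X]lift_out ?mulr0 // ij.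
Qed.

Lemma factor_sum : \sum_k fidem (factor k) = 1.
Proof.
apply: component_inj => j; rewrite rmorph_sum rmorph1 (bigD1 j) //= big1 => [|k kj].
  by rewrite addr0; apply: fproj_idem (factor j).
by apply: lift_out; rewrite eq_sym.
Qed.

Section Assembly.
Variables M N : lmodType R.
Variable g : forall k, {linear comp (factor k) M -> comp (factor k) N}.

Lemma cproj_sum (x : forall k, comp (factor k) M) j :
  cproj (factor j) (\sum_k cval (x k)) = x j.
Proof.
apply: cval_inj; rewrite cprojE scaler_sumr (bigD1 j) //= big1 => [|k kj].
  by rewrite addr0 cval_idem.
by rewrite -cval_idem scalerA factor_orth ?scale0r // eq_sym.
Qed.

Lemma sum_cproj (x : M) : \sum_k cval (cproj (factor k) x) = x.
Proof. by rewrite -{2}[x]scale1r -factor_sum scaler_suml. Qed.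

Lemma assemble_linear : linear (fun x : M => \sum_k cval (g k (cproj (factor k) x))).
Proof.
move=> a x y; rewrite scaler_sumr -big_split; apply: eq_bigr => k _ /=.
by rewrite cprojP linearP cvalD cvalZ flift_proj -scalerA cval_idem.
Qed.

Definition assemble : {linear M -> N} := mk_linear assemble_linear.

End Assembly.

Lemma cproj_assemble M N g j x :
  cproj (factor j) (@assemble M N g x) = g j (cproj (factor j) x).
Proof. exact: (cproj_sum (fun k => g k (cproj (factor k) x))). Qed.

Lemma cproj_ext (M : lmodType R) (x y : M) :
  (forall k, cproj (factor k) x = cproj (factor k) y) -> x = y.
Proof.
by move=> h; rewrite -(sum_cproj x) -(sum_cproj y); apply: eq_bigr => k _; rewrite h.
Qed.

Lemma iso_components (M N : lmodType R) :
  (forall k, isomorphic (comp (factor k) M) (comp (factor k) N)) -> isomorphic M N.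
Proof.
move=> h; have ex k : exists pair : {linear comp (factor k) M -> comp (factor k) N} *
    {linear comp (factor k) N -> comp (factor k) M}, cancel pair.1 pair.2 /\ cancel pair.2 pair.1.
  by have [f [g hK]] := isoP (h k); exists (f, g).
pose pair k := projT1 (cid (ex k)).
have pairP k : cancel (pair k).1 (pair k).2 /\ cancel (pair k).2 (pair k).1.
  by rewrite /pair; case: cid.
apply: (@isoI _ _ _ (assemble (fun k => (pair k).1)) (assemble (fun k => (pair k).2))) => x;
  by apply: cproj_ext => k; have [fK gK] := pairP k; rewrite !cproj_assemble ?fK ?gK.
Qed.

Lemma surj_components (M N : lmodType R) :
  (forall k, exists f : {linear comp (factor k) M -> comp (factor k) N}, surjective f) ->
  exists f : {linear M -> N}, surjective f.
Proof.
move=> ex; pose f k := projT1 (cid (ex k)).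
have fs k : surjective (f k) by rewrite /f; case: cid.
exists (assemble f) => y.
pose x k := projT1 (cid (fs k (cproj (factor k) y))).
have xE k : f k (x k) = cproj (factor k) y by rewrite /x; case: cid.
exists (\sum_k cval (x k)); apply: cproj_ext => k.
by rewrite cproj_assemble cproj_sum xE.
Qed.

End Decomposition.

Theorem theorem6p22 (R : comNzRingType) (P Q : lmodType R)
    (hR : noetherian R) (hP : projective P) (hQ : projective Q) :
  [/\ (s_slender R -> isomorphic (dual P) (dual Q) -> isomorphic P Q),
      (p_slender R ->
        (exists f : {linear dual Q -> dual P}, injective f) ->
        exists g : {linear P -> Q}, surjective g)
    & (t_slender R -> free_module P -> free_module Q ->
        ((exists f : {linear dual Q -> dual P}, injective f) ->
         exists g : {linear P -> Q}, surjective g)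
        /\ (isomorphic (dual P) (dual Q) -> isomorphic P Q))].
Proof.
split.
- move=> [D hD] dPQ; apply: (iso_components (D := D)) => k.
  apply: iso_dual_iso_connected (hD k) _ _ _.
  + exact: component_noetherian.
  + exact: component_connected.
  + exact: comp_projective.
  + exact: comp_projective.
  apply: iso_trans (iso_sym (comp_dual _ P)) _.
  exact: iso_trans (comp_iso _ dPQ) (comp_dual _ Q).
- move=> [D hD] [f fi]; apply: (surj_components (D := D)) => k.
  have [sk qk] := hD k; apply: inj_dual_surj_connected sk qk _ _ _.
  + exact: component_noetherian.
  + exact: component_connected.
  + exact: comp_projective.
  + exact: comp_projective.
  have [a [a' [aK a'K]]] := isoP (comp_dual (factor k) P).
  have [b [b' [bK b'K]]] := isoP (comp_dual (factor k) Q).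
  exists (a \o (comp_map (factor k) f \o b')).
  apply: inj_comp; first exact: can_inj aK.
  by apply: inj_comp; [apply: comp_map_inj | apply: can_inj b'K].
move=> [D [k sk]] /free_module_fs[I PI] /free_module_fs[K QK].
(* The index sets of the free modules are unchanged on the slender component [k], so they can be
   compared there. The claim is general in the modules because an isomorphism of duals uses it in
   both directions. *)
have card (I' K' : choiceType) (M N : lmodType R) :
    isomorphic M (fs I' R^o) -> isomorphic N (fs K' R^o) ->
    (exists f : {linear dual N -> dual M}, injective f) ->
    exists h : K' -> I', injective h.
  move=> MI NK hf; have [theta ti] := dual_inj_functions MI NK hf.
  have [theta' t'i] := factor_functions (factor k) ti.
  exact: slender_card sk t'i.
split=> [hf|/isoP[f [g [fK gK]]]].
  have [h hi] := card _ _ _ _ PI QK hf.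
  by apply: iso_surj PI QK _; exists (fs_comp R^o hi); apply: fs_comp_surj.
have [|h hi] := card _ _ _ _ PI QK; first by exists g; apply: can_inj gK.
have [|h' h'i] := card _ _ _ _ QK PI; first by exists f; apply: can_inj fK.
apply: iso_trans PI _; apply: iso_trans _ (iso_sym QK).
exact: fs_equipotent hi h'i.
Qed.
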